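(* Let $p\in(0,1)$ and fix $u\in(0,1)$. Let $$(m_u(N),n_u(N))=\Big(N,\Big\lfloor \tfrac{N}{p}\big(p+(1-p)u\big)^2\Big\rfloor\Big).$$ Then there exist positive constants $C_1,C_2$, depending on $p$ and $u$, such that for all sufficiently large $N$ $$C_1N^{2/3}\le \mathrm{Var}\big(G^{(u)}_{m_u(N),n_u(N)}\big)\le C_2N^{2/3}.$$
   Context: Notation: $\mathbb{Z}_+=\{0,1,2,\dots\}$, $e_1=(1,0)$, $e_2=(0,1)$. Boundary environment $\omega^{(u)}=\{\omega^{(u)}_{i,j}\}_{(i,j)\in\mathbb{Z}_+^2}$: the weights are independent under $\mathbb{P}$, with $\omega^{(u)}_{i,j}\sim\mathrm{Ber}(p)$ for $i,j\ge1$, $\omega^{(u)}_{i,0}\sim\mathrm{Ber}(u)$ for $i\ge1$, $\omega^{(u)}_{0,j}\sim\mathrm{Ber}\big(\frac{p(1-u)}{u+p(1-u)}\big)$ for $j\ge 1$, and $\omega^{(u)}_{0,0}=0$. An admissible path from $(0,0)$ to $(m,n)\in\mathbb{Z}_+^2$ is a finite sequence of sites starting at $(0,0)$, ending at $(m,n)$, with all steps in $\{e_1,e_2,e_1+e_2\}$. It collects weight as follows: a step along the horizontal axis from $(k-1,0)$ to $(k,0)$ collects $\omega^{(u)}_{k,0}$; a step along the vertical axis from $(0,k-1)$ to $(0,k)$ collects $\omega^{(u)}_{0,k}$; a diagonal step $e_1+e_2$ into a site $v$ collects $\omega^{(u)}_v$; every other step collects $0$. The last passage time $G^{(u)}_{m,n}=G^{(u)}_{0,(m,n)}$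 is the maximum, over all admissible paths from $(0,0)$ to $(m,n)$, of the total collected weight. *)

(* Defs.v *)
From HB Require Import structures.
From mathcomp Require Export all_boot all_order all_algebra.
From mathcomp Require Export all_classical all_reals all_analysis.

Set Implicit Arguments.
Unset Strict Implicit.
Unset Printing Implicit Defensive.

Import Order.TTheory GRing.Theory Num.Theory.

Definition site : Type := (nat * nat)%type.

Definition horizontal (x y : site) : bool := y == (x.1.+1, x.2).
Definition vertical (x y : site) : bool := y == (x.1, x.2.+1).
Definition diagonal (x y : site) : bool := y == (x.1.+1, x.2.+1).

Definition step (x y : site) : bool :=
  [|| horizontal x y, vertical x y | diagonal x y].

(* A path is given by the sequence [s] of its sites after the origin, which is
   left implicit (the head/tail convention of [path]). *)
Definition admissible (m n : nat) (s : seq site) : bool :=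
  path step (0, 0)%N s && (last (0, 0)%N s == (m, n)).

Definition collects (x y : site) : bool :=
  [|| diagonal x y,
      horizontal x y && (y.2 == 0%N)
    | vertical x y && (y.1 == 0%N)].

(* Weights are {0,1}-valued, hence encoded as booleans coerced to [nat]. *)
Definition step_weight (w : site -> bool) (x y : site) : nat :=
  if collects x y then w y : nat else 0%N.

Definition path_weight (w : site -> bool) (s : seq site) : nat :=
  sumn (pairmap (step_weight w) (0, 0)%N s).

Local Open Scope classical_set_scope.
Local Open Scope ring_scope.

(* The supremum is attained, see [last_passage_max]. *)
Definition last_passage (R : realType) (w : site -> bool) (m n : nat) : R :=
  sup [set (path_weight w s)%:R | s in [set s | admissible m n s]].

Definition mutually_independent d d' (T : measurableType d)
    (T' : measurableType d') (R : realType) (P : probability T R)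
    (I : eqType) (X : I -> {RV P >-> T'}) : Prop :=
  forall (s : seq I) (A : I -> set T'), uniq s ->
    (forall i, i \in s -> measurable (A i)) ->
    P (\bigcap_(i in [set` s]) (X i @^-1` A i)) =
    (\prod_(i <- s) P (X i @^-1` A i))%E.

Definition is_bernoulli d (T : measurableType d) (R : realType)
    (P : probability T R) (X : {RV P >-> bool}) (q : R) : Prop :=
  forall A : set bool, distribution P X A = bernoulli_prob q A.

Definition boundary_environment d (T : measurableType d) (R : realType)
    (P : probability T R) (p u : R) (omega : site -> {RV P >-> bool}) : Prop :=
  [/\ mutually_independent omega,
      forall i j : nat, is_bernoulli (omega (i.+1, j.+1)) p,
      forall i : nat, is_bernoulli (omega (i.+1, 0%N)) u,
      forall j : nat,
        is_bernoulli (omega (0%N, j.+1)) (p * (1 - u) / (u + p * (1 - u)))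
    & forall t : T, omega (0%N, 0%N) t = false].

Definition boundary_passage d (T : measurableType d) (R : realType)
    (P : probability T R) (omega : site -> {RV P >-> bool}) (m n : nat) :
    T -> R :=
  fun t => last_passage R (fun x => omega x t) m n.

Definition n_u (R : realType) (p u : R) (N : nat) : nat :=
  Num.truncn (N%:R / p * (p + (1 - p) * u) ^+ 2).

Lemma path_weight_le (w : site -> bool) (x : site) (s : seq site) :
  path step x s ->
  (sumn (pairmap (step_weight w) x s) + (x.1 + x.2)
     <= (last x s).1 + (last x s).2)%N.
Proof.
elim: s x => [|y s IH] x //= /andP[xy /IH]; apply: leq_trans.
rewrite [(step_weight _ _ _ + _)%N]addnC -addnA leq_add2l.
have [lw hw] : (step_weight w x y <= 1)%N /\ (x.1 + x.2 < y.1 + y.2)%N.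
  split; first by rewrite /step_weight; case: ifP => // _; case: (w y).
  by case/or3P: xy => /eqP -> /=; rewrite ?addSn ?addnS.
by rewrite (leq_trans _ hw)// -[(_ + _).+1%N]add1n leq_add2r.
Qed.

Lemma admissible_exists (m n : nat) : exists s, admissible m n s.
Proof.
elim: m => [|m [s /andP[ps /eqP ls]]].
  elim: n => [|n [s /andP[ps /eqP ls]]]; first by exists [::].
  exists (rcons s (0, n.+1)%N); rewrite /admissible rcons_path last_rcons ps ls.
  by rewrite eqxx andbT; apply/or3P/Or32; rewrite /vertical.
exists (rcons s (m.+1, n)); rewrite /admissible rcons_path last_rcons ps ls.
by rewrite eqxx andbT; apply/or3P/Or31; rewrite /horizontal.
Qed.

Lemma last_passage_max (R : realType) (w : site -> bool) (m n : nat) :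
  exists s, [/\ admissible m n s,
    last_passage R w m n = (path_weight w s)%:R
    & forall s', admissible m n s' -> (path_weight w s' <= path_weight w s)%N].
Proof.
pose Q k := `[< exists2 s, admissible m n s & path_weight w s = k >].
have exQ : exists k, Q k.
  have [s hs] := admissible_exists m n.
  by exists (path_weight w s); apply/asboolP; exists s.
have ubQ k : Q k -> (k <= m + n)%N.
  move=> /asboolP[s /andP[ps /eqP ls] <-].
  by have := path_weight_le w ps; rewrite ls /= !addn0.
case: (ex_maxnP exQ ubQ) => k /asboolP[s hs sk] kmax.
have hmax s' : admissible m n s' -> (path_weight w s' <= path_weight w s)%N.
  by move=> hs'; rewrite sk; apply: kmax; apply/asboolP; exists s'.
exists s; split=> //; apply/eqP; rewrite eq_le; apply/andP; split.
  apply: ge_sup; first by exists (path_weight w s)%:R, s.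
  by move=> _ [s' hs' <-]; rewrite ler_nat; exact: hmax.
apply: ub_le_sup; last by exists s.
by exists (path_weight w s)%:R => _ [s' hs' <-]; rewrite ler_nat; exact: hmax.
Qed.

(* Main.v *)
Require Import Defs.
From mathcomp Require Import measurable_realfun ring lra zify.

Set Implicit Arguments.
Unset Strict Implicit.
Unset Printing Implicit Defensive.

Import Order.TTheory GRing.Theory Num.Theory.

(** By a Burke property the increments of the passage time along the north and east
    boundaries are again independent Bernoulli variables. Hence the mean at parameter [w] is
    explicit, and the variance is, up to a bounded error in the characteristic direction,
    twice the covariance with the weights of the horizontal axis; resampling these bits
    shows that this covariance is at most the expected number of [k] such that some nearly
    optimal path stays on the axis for [k] steps. Couple the environments at [u] and
    [w > u]: such a path gains about [k (w - u)] in the second environment, whereas the mean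
    gains only [O(N (w - u)^2)], so with [w - u] of order [k / N] Chebyshev's inequality
    bounds the probability by [O(N^2 (Var + k) / k^4)]. Summing over [k] gives a
    self-consistent inequality that forces [Var = O(N^(2/3))].

    For the lower bound take [w = u + rho N^(-1/3)] with [rho] large. At [w] the mean is
    larger by [c rho^2 N^(1/3)] and, by the same exit bound, the optimal path uses only the
    first [O(rho N^(2/3))] sites of the horizontal axis. Changing the parameter on these
    sites alone costs a bounded chi-square factor, so already at [u] the passage time exceeds
    its mean by [c rho^2 N^(1/3)] with probability bounded below. *)

(** * Last passage times *)

(** Chebyshev's inequality in the coupling involves the variance at [w] as well as at [u], so the
    exit bound is not yet an inequality for the variance at [u] alone. Submodularity closes it:
    raising a bit of the vertical axis gains less when there is more horizontal and less vertical
    weight, so the vertical covariance at [w] is at most a constant times that at [u], and [Var] at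
    [w] is at most a constant times [Var] at [u], plus [O(N (w - u) + 1)].

    In the self-consistent inequality the exit probabilities for [k <= r] are bounded by 1 and the
    others sum to [O(N^2 Var / r^3 + N^2 / r^2)]. For [r] a large multiple of [N^(2/3)] the term
    with [Var] can be absorbed.

    In the lower bound the variances and the exit length are bounded linearly in [rho], while the
    squared mean gain grows like [rho^4]; hence a large [rho] suffices. Tilting the whole axis would
    cost a factor exponential in [N^(1/3)]; tilting the first [O(rho N^(2/3))] sites costs one
    exponential in [rho^3].

    All laws are finite products of coins, treated as linear functionals on functions of bit lists;
    integrals occur only in the final transfer. *)

Fixpoint lpp (w : site -> bool) (i : nat) : nat -> nat :=
  if i is i'.+1 then
    fix row j := if j is j'.+1 then
      maxn (maxn (lpp w i' j'.+1) (row j')) (lpp w i' j' + w (i'.+1, j'.+1))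
    else \sum_(0 <= t < i'.+1) w (t.+1, 0%N)
  else fun j => \sum_(0 <= t < j) w (0%N, t.+1).

Lemma lpp0j w j : lpp w 0 j = \sum_(0 <= t < j) w (0%N, t.+1).
Proof. by []. Qed.

Lemma lppi0 w i : lpp w i 0 = \sum_(0 <= t < i) w (t.+1, 0%N).
Proof. by case: i => [|i] //=; rewrite !big_nil. Qed.

Lemma lppSS w i j : lpp w i.+1 j.+1 =
  maxn (maxn (lpp w i j.+1) (lpp w i.+1 j)) (lpp w i j + w (i.+1, j.+1)).
Proof. by []. Qed.

Lemma step_weight_horizontal w i j :
  step_weight w (i, j) (i.+1, j) = if j == 0 then w (i.+1, 0) : nat else 0.
Proof.
rewrite /step_weight /collects /diagonal /horizontal /vertical /= !xpair_eqE /=.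
by case: j => [|j] /=; rewrite !eqxx ?orbT //= ?andbF !ltn_eqF.
Qed.

Lemma step_weight_vertical w i j :
  step_weight w (i, j) (i, j.+1) = if i == 0 then w (0, j.+1) : nat else 0.
Proof.
rewrite /step_weight /collects /diagonal /horizontal /vertical /= !xpair_eqE /=.
by case: i => [|i] /=; rewrite !eqxx ?orbT //= ?andbF ?orbF ?ltn_eqF.
Qed.

Lemma step_weight_diagonal w i j : step_weight w (i, j) (i.+1, j.+1) = w (i.+1, j.+1).
Proof. by rewrite /step_weight /collects /diagonal eqxx. Qed.

Lemma lpp_step w x y : step x y ->
  lpp w x.1 x.2 + step_weight w x y <= lpp w y.1 y.2.
Proof.
case: x => i j /or3P[] /eqP -> /=.
- rewrite step_weight_horizontal; case: j => [|j] /=.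
    by rewrite lppi0 -big_nat_recr.
  by rewrite addn0 -maxnA leq_maxl.
- rewrite step_weight_vertical; case: i => [|i] /=.
    by rewrite -big_nat_recr.
  by rewrite addn0 [maxn (lpp _ _ _) _]maxnC -maxnA leq_maxl.
- by rewrite step_weight_diagonal leq_maxr.
Qed.

Lemma path_weight_rcons w s y :
  path_weight w (rcons s y) = path_weight w s + step_weight w (last (0, 0) s) y.
Proof. by rewrite /path_weight -cats1 pairmap_cat sumn_cat /= addn0. Qed.

Lemma path_weight_lpp w m n s : admissible m n s -> path_weight w s <= lpp w m n.
Proof.
case/andP; elim/last_ind: s m n => [|s y IH] m n.
  by move=> _ /eqP [<- <-]; rewrite /= big_nil.
rewrite rcons_path last_rcons path_weight_rcons => /andP[ps sy] /eqP yE.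
have := lpp_step w sy; rewrite yE /=; apply: leq_trans; rewrite leq_add2r.
by apply: IH => //; case: (last _ _).
Qed.

Lemma lpp_pred w i j : 0 < i + j -> exists2 x, step x (i, j) &
  lpp w i j = lpp w x.1 x.2 + step_weight w x (i, j).
Proof.
case: i j => [|i] [|j] // _.
- exists (0, j); first by apply/or3P/Or32/eqP.
  by rewrite step_weight_vertical /= big_nat_recr.
- exists (i, 0); first by apply/or3P/Or31/eqP.
  by rewrite step_weight_horizontal !lppi0 big_nat_recr.
- rewrite lppSS; case: (leqP (maxn (lpp w i j.+1) (lpp w i.+1 j))) => h.
    exists (i, j); first by apply/or3P/Or33/eqP.
    by rewrite step_weight_diagonal.
  case: leqP => h'.
    exists (i.+1, j); first by apply/or3P/Or32/eqP.
    by rewrite step_weight_vertical addn0.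
  exists (i, j.+1); first by apply/or3P/Or31/eqP.
  by rewrite step_weight_horizontal addn0.
Qed.

Lemma lpp_attained w m n : exists2 s, admissible m n s & path_weight w s = lpp w m n.
Proof.
have [k] := ubnP (m + n); elim: k m n => // k IH m n.
rewrite ltnS => mn; have [|] := posnP (m + n).
  by move/eqP; rewrite addn_eq0 => /andP[/eqP-> /eqP->]; exists [::] => //=; rewrite big_nil.
move=> /lpp_pred - /(_ w)[[i j] sx ->].
have ij : i + j < m + n by case/or3P: sx => /eqP[-> ->] /=; rewrite ?addSn ?addnS.
have [s /andP[ps /eqP ls] <-] := IH i j (leq_trans ij mn).
exists (rcons s (m, n)).
  by rewrite /admissible rcons_path last_rcons ps ls sx eqxx.
by rewrite path_weight_rcons ls.
Qed.

Lemma last_passage_lpp (R : realType) w m n :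
  last_passage R w m n = (lpp w m n)%:R%R.
Proof.
have [s [as_ -> smax]] := last_passage_max R w m n; congr (_%:R)%R.
apply/eqP; rewrite eqn_leq path_weight_lpp//=.
by have [s' as' <-] := lpp_attained w m n; exact: smax.
Qed.

(** * Increments *)

Definition hinc w i j : bool := lpp w i j < lpp w i.+1 j.
Definition vinc w i j : bool := lpp w i j < lpp w i j.+1.

(** Both claims go into one induction, because the increments on the north and east edges of a cell
    are determined by those on its south and west edges and the bulk bit. *)
Lemma hinc_vinc w i j :
  lpp w i.+1 j = lpp w i j + hinc w i j /\ lpp w i j.+1 = lpp w i j + vinc w i j.
Proof.
rewrite /hinc /vinc.
have [k] := ubnP (i + j); elim: k i j => // k IH i j; rewrite ltnS => ij.
split.
- case: j ij => [|j] ij.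
    by rewrite !lppi0 big_nat_recr//=; case: (w _); rewrite ?addn0 ?addn1 ?ltnSn ?ltnn /=; lia.
  have [|h v] := IH i j; first by lia.
  by rewrite lppSS; case: (w _) h v; lia.
- case: i ij => [|i] ij.
    by rewrite !lpp0j big_nat_recr//=; case: (w _); rewrite ?addn0 ?addn1 ?ltnSn ?ltnn /=; lia.
  have [|h v] := IH i j; first by lia.
  by rewrite lppSS; case: (w _) h v; lia.
Qed.

Lemma lppSi w i j : lpp w i.+1 j = lpp w i j + hinc w i j.
Proof. by have [] := hinc_vinc w i j. Qed.

Lemma lppSj w i j : lpp w i j.+1 = lpp w i j + vinc w i j.
Proof. by have [] := hinc_vinc w i j. Qed.

Lemma hinc0 w i : hinc w i 0 = w (i.+1, 0).
Proof. by rewrite /hinc !lppi0 big_nat_recr//=; case: (w _); lia. Qed.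

Lemma vinc0 w j : vinc w 0 j = w (0, j.+1).
Proof. by rewrite /vinc !lpp0j big_nat_recr//=; case: (w _); lia. Qed.

(** Across a cell the passage time grows by the maximum of the south increment, the west increment
    and the bulk bit; removing the west increment leaves this local rule. *)
Lemma hincS w i j :
  hinc w i j.+1 = ~~ vinc w i j && (hinc w i j || w (i.+1, j.+1)).
Proof.
have := lppSi w i j; have := lppSj w i j; have := lppSS w i j; rewrite [hinc w i j.+1]/hinc.
by case: (hinc w i j); case: (vinc w i j); case: (w _) => /=; lia.
Qed.

Lemma vincS w i j :
  vinc w i.+1 j = ~~ hinc w i j && (vinc w i j || w (i.+1, j.+1)).
Proof.
have := lppSi w i j; have := lppSj w i j; have := lppSS w i j; rewrite [vinc w i.+1 j]/vinc.
by case: (hinc w i j); case: (vinc w i j); case: (w _) => /=; lia.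
Qed.

Lemma lpp_hsum w i j : lpp w i j = lpp w 0 j + \sum_(0 <= t < i) hinc w t j.
Proof.
elim: i => [|i IH]; first by rewrite big_nil addn0.
by rewrite lppSi IH big_nat_recr//= addnA.
Qed.

Lemma lpp_vsum w i j : lpp w i j = lpp w i 0 + \sum_(0 <= t < j) vinc w i t.
Proof.
elim: j => [|j IH]; first by rewrite big_nil addn0.
by rewrite lppSj IH big_nat_recr//= addnA.
Qed.

(** * Exit points *)

(** Counting steps on the axis gives the exit point, since a path from the origin that leaves an
    axis never returns to it. *)
Definition hexit_from (x : site) (s : seq site) : nat :=
  sumn (pairmap (fun x y => (horizontal x y && (y.2 == 0)) : nat) x s).
Definition vexit_from (x : site) (s : seq site) : nat :=
  sumn (pairmap (fun x y => (vertical x y && (y.1 == 0)) : nat) x s).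
Definition bulk_from (w : site -> bool) (x : site) (s : seq site) : nat :=
  sumn (pairmap (fun x y => if diagonal x y then w y : nat else 0) x s).

Definition hexit := hexit_from (0, 0).
Definition vexit := vexit_from (0, 0).
Definition bulk_weight w := bulk_from w (0, 0).

Lemma eq_bulk_from (w w' : site -> bool) x s : (forall i j, w (i.+1, j.+1) = w' (i.+1, j.+1)) ->
  bulk_from w x s = bulk_from w' x s.
Proof.
move=> ww'; elim: s x => [//|y s IH] x; rewrite /bulk_from /= -/(bulk_from _ _ _) IH.
by congr (_ + _); case: ifP => // /eqP ->; rewrite ww'.
Qed.

Lemma exits_bulk w i j s : path step (i.+1, j.+1) s ->
  [/\ hexit_from (i.+1, j.+1) s = 0, vexit_from (i.+1, j.+1) s = 0 &
   sumn (pairmap (step_weight w) (i.+1, j.+1) s) = bulk_from w (i.+1, j.+1) s].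
Proof.
elim: s i j => [//|y s IH] i j /= /andP[].
rewrite /hexit_from /vexit_from /bulk_from /=.
case/or3P=> /eqP -> /= /IH[h v b]; move: h v b; rewrite /hexit_from /vexit_from /bulk_from => -> -> ->.
all: rewrite ?step_weight_diagonal ?step_weight_horizontal ?step_weight_vertical /=.
all: rewrite ?andbF /diagonal /= ?xpair_eqE ?eqxx //= ?[_ == _.+1]ltn_eqF ?andbF //=.
Qed.

Lemma exits_haxis w i s : path step (i.+1, 0) s ->
  [/\ vexit_from (i.+1, 0) s = 0 &
   sumn (pairmap (step_weight w) (i.+1, 0) s) =
   \sum_(i.+1 <= t < i.+1 + hexit_from (i.+1, 0) s) w (t.+1, 0) + bulk_from w (i.+1, 0) s].
Proof.
elim: s i => [|y s IH] i /=; first by rewrite /hexit_from /vexit_from /= addn0 big_geq.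
rewrite /hexit_from /vexit_from /bulk_from /= => /andP[].
case/or3P=> /eqP -> /=.
- move=> /IH[]; rewrite /hexit_from /vexit_from /bulk_from => -> ->.
  rewrite step_weight_horizontal /= /horizontal /diagonal /vertical /= !xpair_eqE eqxx !andbF /=.
  split => //; rewrite add0n addnA; congr (_ + _).
  by rewrite [in RHS]big_ltn ?addnA ?addn1 //; lia.
- move=> /(exits_bulk w)[]; rewrite /hexit_from /vexit_from /bulk_from => -> -> ->.
  rewrite step_weight_vertical /= andbF /diagonal /= xpair_eqE /= andbF /=.
  by rewrite !addn0 big_geq// ltn_eqF.
- move=> /(exits_bulk w)[]; rewrite /hexit_from /vexit_from /bulk_from => -> -> ->.
  by rewrite step_weight_diagonal /= ?andbF /= !addn0 big_geq// /diagonal eqxx.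
Qed.

Lemma exits_vaxis w j s : path step (0, j.+1) s ->
  [/\ hexit_from (0, j.+1) s = 0 &
   sumn (pairmap (step_weight w) (0, j.+1) s) =
   \sum_(j.+1 <= t < j.+1 + vexit_from (0, j.+1) s) w (0, t.+1) + bulk_from w (0, j.+1) s].
Proof.
elim: s j => [|y s IH] j /=; first by rewrite /hexit_from /vexit_from /= addn0 big_geq.
rewrite /hexit_from /vexit_from /bulk_from /= => /andP[].
case/or3P=> /eqP -> /=.
- move=> /(exits_bulk w)[]; rewrite /hexit_from /vexit_from /bulk_from => -> -> ->.
  rewrite step_weight_horizontal /= andbF /diagonal /= xpair_eqE /=.
  by rewrite !addn0 big_geq// ltn_eqF.
- move=> /IH[]; rewrite /hexit_from /vexit_from /bulk_from => -> ->.
  rewrite step_weight_vertical /= /horizontal /diagonal /vertical /= !xpair_eqE !eqxx /=.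
  split => //; rewrite add0n addnA; congr (_ + _).
  by rewrite ?eqxx [in RHS]big_ltn ?addnA ?addn1 //; lia.
- move=> /(exits_bulk w)[]; rewrite /hexit_from /vexit_from /bulk_from => -> -> ->.
  by rewrite step_weight_diagonal /= ?andbF /= !addn0 big_geq// /diagonal eqxx.
Qed.

(** Before entering the interior a path can follow only one axis, and from the interior it never
    comes back; so only an initial segment of one axis is collected. *)
Lemma path_weight_exits w m n s : admissible m n s ->
  (hexit s = 0 \/ vexit s = 0) /\
  path_weight w s = \sum_(0 <= t < hexit s) w (t.+1, 0) +
    \sum_(0 <= t < vexit s) w (0, t.+1) + bulk_weight w s.
Proof.
case/andP; rewrite /hexit /vexit /bulk_weight /path_weight => + _.
case: s => [|y s] /=; first by rewrite !big_nil; split; first left.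
rewrite /hexit_from /vexit_from /bulk_from /= => /andP[].
case/or3P=> /eqP -> /=.
- move=> /(exits_haxis w)[]; rewrite /hexit_from /vexit_from /bulk_from => -> ->.
  rewrite step_weight_horizontal /=; split; first by right.
  by rewrite big_nil [in RHS]big_ltn//; lia.
- move=> /(exits_vaxis w)[]; rewrite /hexit_from /vexit_from /bulk_from => -> ->.
  rewrite step_weight_vertical /=; split; first by left.
  by rewrite big_nil [in RHS]big_ltn//; lia.
- move=> /(exits_bulk w)[]; rewrite /hexit_from /vexit_from /bulk_from => -> -> ->.
  by rewrite step_weight_diagonal !addn0 !big_nil; split; first left.
Qed.

(** * Monotonicity, changes of boundary bits and comparison of environments *)

Definition upd (w : site -> bool) (x : site) (b : bool) : site -> bool :=
  fun y => if y == x then b else w y.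

Lemma path_weight_mono (w w' : site -> bool) s : (forall y, w y -> w' y) -> path_weight w s <= path_weight w' s.
Proof.
move=> ww'; rewrite /path_weight; elim: s (0, 0) => [//|y s IH] x /=.
apply: leq_add (IH y); rewrite /step_weight; case: ifP => // _.
by have := ww' y; case: (w y) => // ->.
Qed.

Lemma lpp_le_paths (w w' : site -> bool) m n c :
  (forall s, admissible m n s -> path_weight w s <= path_weight w' s + c) ->
  lpp w m n <= lpp w' m n + c.
Proof.
move=> h; have [s adm <-] := lpp_attained w m n; apply: leq_trans (h s adm) _.
by rewrite leq_add2r path_weight_lpp.
Qed.

Lemma lpp_mono (w w' : site -> bool) m n : (forall y, w y -> w' y) -> lpp w m n <= lpp w' m n.
Proof.
move=> ww'; rewrite -[leqRHS]addn0; apply: lpp_le_paths => s _.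
by rewrite addn0 path_weight_mono.
Qed.

Lemma sum_le_except (f g : nat -> bool) i k : (forall t, t != i -> f t -> g t) ->
  \sum_(0 <= t < k) f t <= \sum_(0 <= t < k) g t + (i < k).
Proof.
move=> fg; elim: k => [|k IH]; first by rewrite !big_nil.
rewrite !big_nat_recr//=; have := fg k; case: eqVneq => [ki _|ki /(_ isT)].
  by subst i; move: IH; rewrite ltnn ltnSn; case: (f k); case: (g k); lia.
by case: (f k) => [->//|_]; lia.
Qed.

Lemma sum_mono (f g : nat -> bool) k l : (forall t, k <= t < l -> f t -> g t) ->
  \sum_(k <= t < l) f t <= \sum_(k <= t < l) g t.
Proof.
move=> fg; rewrite big_nat [leqRHS]big_nat; apply: leq_sum => t /fg.
by case: (f t) => // ->.
Qed.

Lemma sum_split (f : nat -> bool) k l : k <= l ->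
  \sum_(0 <= t < l) f t = \sum_(0 <= t < k) f t + \sum_(k <= t < l) f t.
Proof. by move=> kl; exact: big_cat_nat. Qed.

Lemma path_weight_hupd w i m n s : admissible m n s ->
  path_weight (upd w (i.+1, 0) true) s <=
  path_weight (upd w (i.+1, 0) false) s + (i < hexit s).
Proof.
move=> adm; rewrite !(proj2 (path_weight_exits _ adm)).
rewrite /bulk_weight (@eq_bulk_from _ (upd w (i.+1, 0) false)) => [|a b]; last first.
  by rewrite /upd !xpair_eqE andbF.
rewrite [leqRHS]addnAC leq_add2r [leqRHS]addnAC; apply: leq_add.
  by apply: sum_le_except => t ti; rewrite /upd !xpair_eqE eqSS (negbTE ti).
by apply: sum_mono => t _; rewrite /upd !xpair_eqE.
Qed.

Lemma path_weight_vupd w j m n s : admissible m n s ->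
  path_weight (upd w (0, j.+1) true) s <=
  path_weight (upd w (0, j.+1) false) s + (j < vexit s).
Proof.
move=> adm; rewrite !(proj2 (path_weight_exits _ adm)).
rewrite /bulk_weight (@eq_bulk_from _ (upd w (0, j.+1) false)) => [|a b]; last first.
  by rewrite /upd !xpair_eqE.
rewrite [leqRHS]addnAC leq_add2r -addnA; apply: leq_add.
  by apply: sum_mono => t _; rewrite /upd !xpair_eqE andbF.
by apply: sum_le_except => t ti; rewrite /upd !xpair_eqE eqSS (negbTE ti).
Qed.

Lemma upd_mono w x y : upd w x false y -> upd w x true y.
Proof. by rewrite /upd; case: eqP. Qed.

(* The slack [1] absorbs the effect of flipping one boundary bit. *)
Definition hexit_event w m n k : bool :=
  `[< exists2 s, admissible m n s & (k <= hexit s) && (lpp w m n <= path_weight w s + 1) >].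

(** A gain requires that the optimal path chosen for the raised bit runs along the axis through that
    bit. Lowering the bit costs this path at most 1, so it is optimal up to 1 for [w], whatever the
    bit is there. *)
Lemma lpp_hupd_event w m n i :
  lpp (upd w (i.+1, 0) true) m n <=
  lpp (upd w (i.+1, 0) false) m n + hexit_event w m n i.+1.
Proof.
have [s adm sE] := lpp_attained (upd w (i.+1, 0) true) m n.
have h := path_weight_hupd w i adm; have [hs|hs] := leqP (hexit s) i.
  rewrite -sE; apply: leq_trans h _; rewrite ltnNge hs addn0.
  by apply: leq_trans (path_weight_lpp _ adm) _; exact: leq_addr.
suff -> : hexit_event w m n i.+1.
  by apply: lpp_le_paths => s' /path_weight_hupd /leq_trans; apply; rewrite leq_add2l leq_b1.
apply/asboolP; exists s => //; rewrite hs /=.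
have h1 : lpp w m n <= lpp (upd w (i.+1, 0) true) m n.
  by apply: lpp_mono => y; rewrite /upd; case: eqP.
apply: leq_trans h1 _; rewrite -sE; apply: leq_trans h _; rewrite hs leq_add2r.
by apply: path_weight_mono => y; rewrite /upd; case: eqP.
Qed.

(** The nearly optimal path of [w] is followed in [w']: it collects the extra weight of the first
    [k] sites, loses nothing beyond them, and sees the same bulk. Since [0 < k], it avoids the
    vertical axis, where nothing is assumed. *)
Lemma hexit_event_gap (w w' : site -> bool) m n k : 0 < k ->
  (forall i j, w (i.+1, j.+1) = w' (i.+1, j.+1)) ->
  (forall t, w (t.+1, 0) -> w' (t.+1, 0)) -> hexit_event w m n k ->
  lpp w m n + \sum_(0 <= t < k) w' (t.+1, 0) <=
  lpp w' m n + \sum_(0 <= t < k) w (t.+1, 0) + 1.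
Proof.
move=> k0 bulk ww' /asboolP[s adm /andP[ks opt]].
have := path_weight_lpp w' adm; move: opt.
have [hv ->] := path_weight_exits w adm; have [_ ->] := path_weight_exits w' adm.
have -> : vexit s = 0 by case: hv => //; lia.
rewrite !big_nil (eq_bulk_from _ _ bulk : bulk_weight w s = bulk_weight w' s).
rewrite (sum_split (fun t => w (t.+1, 0)) ks) (sum_split (fun t => w' (t.+1, 0)) ks).
have := @sum_mono (fun t => w (t.+1, 0)) (fun t => w' (t.+1, 0)) k (hexit s)
  (fun t _ => ww' t).
lia.
Qed.

(* Submodularity: the gain from raising a vertical boundary weight is larger in an
   environment with more vertical and less horizontal boundary weight. *)
Lemma lpp_vupd_submodular (w w' : site -> bool) m n j :
  (forall i j, w (i.+1, j.+1) = w' (i.+1, j.+1)) ->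
  (forall t, w' (t.+1, 0) -> w (t.+1, 0)) -> (forall t, w (0, t.+1) -> w' (0, t.+1)) ->
  lpp (upd w (0, j.+1) true) m n + lpp (upd w' (0, j.+1) false) m n <=
  lpp (upd w' (0, j.+1) true) m n + lpp (upd w (0, j.+1) false) m n.
Proof.
move=> bulk hw vw; set w1 := upd w _ true; set w0 := upd w _ false.
set w1' := upd w' _ true; set w0' := upd w' _ false.
have [s adm sE] := lpp_attained w1 m n; have [t admt tE] := lpp_attained w0' m n.
(* If [s] avoids the changed site, raising it gains nothing in [w]. *)
have [sj|sj] := leqP (vexit s) j.
  rewrite addnC; apply: leq_add; first by apply: lpp_mono => y; exact: upd_mono.
  have := path_weight_vupd w j adm; rewrite -/w1 -/w0 sE ltnNge sj addn0 => /leq_trans; apply.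
  exact: path_weight_lpp.
rewrite -sE -tE.
have bulk1 a : bulk_weight w1 a = bulk_weight w1' a.
  by apply: eq_bulk_from => x y; rewrite /w1 /w1' /upd !xpair_eqE /= bulk.
have bulk0 a : bulk_weight w0' a = bulk_weight w0 a.
  by apply: eq_bulk_from => x y; rewrite /w0 /w0' /upd !xpair_eqE /= bulk.
(* If [t] uses the changed site even when lowered, the gain in [w'] is 1, the largest possible. *)
have [tj|tj] := ltnP j (vexit t).
  have h1 : path_weight w0' t + 1 <= lpp w1' m n.
    apply: leq_trans (path_weight_lpp w1' admt).
    have [ht ->] := path_weight_exits w0' admt; have [_ ->] := path_weight_exits w1' admt.
    have -> : hexit t = 0 by case: ht => // ht; rewrite ht in tj.
    have -> : bulk_weight w0' t = bulk_weight w1' t.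
      by apply: eq_bulk_from => x y; rewrite /w0' /w1' /upd !xpair_eqE.
    rewrite !big_nil !add0n addnAC leq_add2r.
    rewrite (sum_split (fun t => w0' (0, t.+1)) (ltnW tj)).
    rewrite (sum_split (fun t => w1' (0, t.+1)) (ltnW tj)).
    rewrite !(big_ltn tj) /=.
    have e x : w0' (0, x) = if x == j.+1 then false else w' (0, x) by [].
    have e1 x : w1' (0, x) = if x == j.+1 then true else w' (0, x) by [].
    have l1 := @sum_mono (fun t => w0' (0, t.+1)) (fun t => w1' (0, t.+1)) 0 j
       (fun t _ => @upd_mono w' (0, j.+1) (0, t.+1)).
    have l2 := @sum_mono (fun t => w0' (0, t.+1)) (fun t => w1' (0, t.+1)) j.+1 (vexit t)
       (fun t _ => @upd_mono w' (0, j.+1) (0, t.+1)).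
    by rewrite e e1 eqxx; lia.
  have h2 : path_weight w1 s <= lpp w0 m n + 1.
    apply: leq_trans (path_weight_vupd w j adm) _; rewrite -/w0 sj leq_add2r.
    exact: path_weight_lpp.
  by lia.
(* Now [vexit t <= j < vexit s], and the paths exchange environments. The stretch of vertical axis
   below [vexit t] contributes the same total; the rest of the stretch of [s] gains from [w] to
   [w'], the horizontal stretch of [t] from [w'] to [w]. *)
have h1 := path_weight_lpp w1' adm; have h2 := path_weight_lpp w0 admt.
suff : path_weight w1 s + path_weight w0' t <= path_weight w1' s + path_weight w0 t by lia.
have [hs ->] := path_weight_exits w1 adm; have [_ ->] := path_weight_exits w1' adm.
have [_ ->] := path_weight_exits w0' admt; have [_ ->] := path_weight_exits w0 admt.
have -> : hexit s = 0 by case: hs => // hs; rewrite hs in sj.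
rewrite bulk1 bulk0 !big_nil.
have ts : vexit t <= vexit s by apply: leq_trans tj (ltnW sj).
rewrite (sum_split (fun t => w1 (0, t.+1)) ts) (sum_split (fun t => w1' (0, t.+1)) ts).
have e1 : \sum_(0 <= i < vexit t) w1 (0, i.+1) = \sum_(0 <= i < vexit t) w0 (0, i.+1).
  by apply: eq_big_nat => i /andP[_ it]; rewrite /w1 /w0 /upd xpair_eqE /= eqSS ltn_eqF//; lia.
have e2 : \sum_(0 <= i < vexit t) w1' (0, i.+1) = \sum_(0 <= i < vexit t) w0' (0, i.+1).
  by apply: eq_big_nat => i /andP[_ it]; rewrite /w1' /w0' /upd xpair_eqE /= eqSS ltn_eqF//; lia.
have e3 := @sum_mono (fun i => w1 (0, i.+1)) (fun i => w1' (0, i.+1)) (vexit t) (vexit s).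
have e4 := @sum_mono (fun i => w0' (i.+1, 0)) (fun i => w0 (i.+1, 0)) 0 (hexit t).
have {}e3 : \sum_(vexit t <= i < vexit s) w1 (0, i.+1) <=
            \sum_(vexit t <= i < vexit s) w1' (0, i.+1).
  by apply: e3 => i _; rewrite /w1 /w1' /upd; case: eqP => // _; exact: vw.
have {}e4 : \sum_(0 <= i < hexit t) w0' (i.+1, 0) <= \sum_(0 <= i < hexit t) w0 (i.+1, 0).
  by apply: e4 => i _; rewrite /w0 /w0' /upd; case: eqP => // _; exact: hw.
by move: e1 e2 e3 e4; lia.
Qed.

(** Outside the event an optimal path leaves the horizontal axis before [k], so the horizontal
    weights from there on do not enter. *)
Lemma lpp_early_exit (w w' : site -> bool) m n k : ~~ hexit_event w m n k ->
  (forall i j, w (i.+1, j.+1) = w' (i.+1, j.+1)) ->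
  (forall t, t < k -> w (t.+1, 0) -> w' (t.+1, 0)) ->
  (forall t, w (0, t.+1) -> w' (0, t.+1)) -> lpp w m n <= lpp w' m n.
Proof.
move=> /asboolPn nex bulk hw vw.
have [s adm sE] := lpp_attained w m n.
have sk : hexit s < k.
  rewrite ltnNge; apply/negP => ks; apply: nex; exists s => //.
  by rewrite ks sE leq_addr.
apply: leq_trans (path_weight_lpp w' adm); rewrite -sE.
have [_ ->] := path_weight_exits w adm; have [_ ->] := path_weight_exits w' adm.
rewrite (eq_bulk_from _ _ bulk : bulk_weight w s = bulk_weight w' s) leq_add2r.
apply: leq_add; apply: sum_mono => t /andP[_ ts]; last exact: vw.
by apply: hw; lia.
Qed.

(** * The stationary environment *)

(* The bits of the horizontal axis, then for each row above it the bit on the vertical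
   axis followed by the bits of the bulk. *)
Definition env : Type := (seq bool * seq (bool * seq bool))%type.

Definition wt (e : env) (x : site) : bool :=
  match x with
  | (i.+1, 0) => nth false e.1 i
  | (0, j.+1) => (nth (false, [::]) e.2 j).1
  | (i.+1, j.+1) => nth false (nth (false, [::]) e.2 j).2 i
  | (0, 0) => false
  end.

Definition env_size (m n : nat) (e : env) : Prop :=
  [/\ size e.1 = m, size e.2 = n & all (fun r => size r.2 == m) e.2].

Lemma wt_hset e i x : wt (set_nth false e.1 i x, e.2) = upd (wt e) (i.+1, 0) x.
Proof.
apply/funext => -[[|k] [|l]] //=; rewrite /upd xpair_eqE /= ?andbF //.
by rewrite andbT eqSS nth_set_nth.
Qed.

Lemma wt_vset e j x :
  wt (e.1, set_nth (false, [::]) e.2 j (x, (nth (false, [::]) e.2 j).2)) =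
  upd (wt e) (0, j.+1) x.
Proof.
apply/funext => -[[|k] [|l]] //=; rewrite /upd xpair_eqE /= ?andbF //= ?eqSS nth_set_nth /=.
  by case: eqP.
by case: eqP => // ->.
Qed.

(** Increments carried across one row: [a] on its south side, [b] on its west side, [o] the bulk
    bits. The result holds the north increments and the east increment, each cell obeying [hincS]
    and [vincS]. *)
Fixpoint cross_row (a : seq bool) (b : bool) (o : seq bool) : seq bool * bool :=
  match a, o with
  | x :: a', y :: o' =>
    let r := cross_row a' (~~ x && (b || y)) o' in ((~~ b && (x || y)) :: r.1, r.2)
  | _, _ => ([::], b)
  end.

Fixpoint cross (a : seq bool) (rows : seq (bool * seq bool)) : seq bool * seq bool :=
  if rows is r :: rows' then
    let q := cross_row a r.1 r.2 in
    ((cross q.1 rows').1, q.2 :: (cross q.1 rows').2)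
  else (a, [::]).

Lemma cross_row_inc w i j k :
  cross_row [seq hinc w t j | t <- iota i k] (vinc w i j)
    [seq w (t.+1, j.+1) | t <- iota i k] =
  ([seq hinc w t j.+1 | t <- iota i k], vinc w (i + k) j).
Proof.
elim: k i => [|k IH] i /=; first by rewrite addn0.
by rewrite -vincS -hincS IH addSnnS.
Qed.

Lemma cross_inc w m j k :
  cross [seq hinc w t j | t <- iota 0 m]
    [seq (w (0, l.+1), [seq w (t.+1, l.+1) | t <- iota 0 m]) | l <- iota j k] =
  ([seq hinc w t (j + k) | t <- iota 0 m], [seq vinc w m l | l <- iota j k]).
Proof.
elim: k j => [|k IH] j /=; first by rewrite addn0.
by rewrite -vinc0 cross_row_inc /= IH addSnnS.
Qed.

Lemma cross_env m n e : env_size m n e ->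
  cross e.1 e.2 =
  ([seq hinc (wt e) t n | t <- iota 0 m], [seq vinc (wt e) m l | l <- iota 0 n]).
Proof.
case: e => a rows [/= sa sr /allP ar].
rewrite -(cross_inc (wt (a, rows)) m 0 n); congr cross.
  rewrite -{1}(mkseq_nth false a) sa; apply: eq_map => i.
  by rewrite hinc0.
rewrite -{1}(mkseq_nth (false, [::]) rows) sr; apply/eq_in_map => l.
rewrite mem_iota /= => ln; have /ar/eqP : nth (false, [::]) rows l \in rows.
  by rewrite mem_nth// sr.
by case E : nth => [b o] /= <-; congr pair; rewrite -[LHS](mkseq_nth false).
Qed.

Local Open Scope ring_scope.

(** * Expectation functionals *)

Section Expectation.
Variable R : realType.

(** A positive linear functional of mass one on all functions, so that no measurability or
    integrability condition arises. *)
Record is_expectation (T : Type) (E : (T -> R) -> R) : Prop := IsExpectation {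
  ex_linear : forall c f g, E (fun x => c * f x + g x) = c * E f + E g;
  ex_le : forall f g, (forall x, f x <= g x) -> E f <= E g;
  ex_one : E (fun=> 1) = 1 }.

(** Being carried by [Q], phrased through comparison of functions; it allows lists of the wrong
    length to be ignored. *)
Definition supported (T : Type) (E : (T -> R) -> R) (Q : T -> Prop) :=
  forall f g, (forall x, Q x -> f x <= g x) -> E f <= E g.

Definition ex_var (T : Type) (E : (T -> R) -> R) (f : T -> R) : R :=
  E (fun x => (f x - E f) ^+ 2).

Section Theory.
Variables (T : Type) (E : (T -> R) -> R).

Lemma eq_ex (f g : T -> R) : f =1 g -> E f = E g.
Proof. by move=> /funext ->. Qed.

Lemma supported_eq (Q : T -> Prop) (f g : T -> R) :
  supported E Q -> (forall x, Q x -> f x = g x) -> E f = E g.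
Proof.
move=> sE fg; apply/eqP; rewrite eq_le.
by apply/andP; split; apply: sE => x /fg ->.
Qed.

Hypothesis hE : is_expectation E.

Lemma ex0 : E (fun=> 0) = 0.
Proof.
have := ex_linear hE (- 1) (fun=> 0) (fun=> 0).
by rewrite (_ : (fun=> _) = (fun=> 0)); [lra | apply/funext => x; lra].
Qed.

Lemma exD f g : E (fun x => f x + g x) = E f + E g.
Proof. by rewrite -[E f]mul1r -(ex_linear hE); apply: eq_ex => x; rewrite mul1r. Qed.

Lemma exZ c f : E (fun x => c * f x) = c * E f.
Proof.
by rewrite -[RHS]addr0 -ex0 -(ex_linear hE); apply: eq_ex => x; rewrite addr0.
Qed.

Lemma exN f : E (fun x => - f x) = - E f.
Proof. by rewrite -mulN1r -exZ; apply: eq_ex => x; rewrite mulN1r. Qed.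

Lemma exB f g : E (fun x => f x - g x) = E f - E g.
Proof. by rewrite exD exN. Qed.

Lemma ex_cst c : E (fun=> c) = c.
Proof. by rewrite -[RHS]mulr1 -[in RHS](ex_one hE) -exZ mulr1. Qed.

Lemma ex_ge0 f : (forall x, 0 <= f x) -> 0 <= E f.
Proof. by rewrite -{2}ex0; exact: ex_le. Qed.

Lemma ex_sum (I : Type) (r : seq I) (f : I -> T -> R) :
  E (fun x => \sum_(i <- r) f i x) = \sum_(i <- r) E (f i).
Proof.
elim: r => [|i r IH].
  by rewrite big_nil -[RHS]ex0; apply: eq_ex => x; rewrite big_nil.
by rewrite big_cons -IH -exD; apply: eq_ex => x; rewrite big_cons.
Qed.

Lemma ex_var_ge0 f : 0 <= ex_var E f.
Proof. by apply: ex_ge0 => x; exact: sqr_ge0. Qed.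

Lemma chebyshev f c : 0 < c ->
  E (fun x => (c <= `|f x - E f|)%R%:R) <= ex_var E f / c ^+ 2.
Proof.
move=> c0; rewrite ler_pdivlMr ?exprn_gt0// mulrC -exZ.
apply: (ex_le hE) => x; case: (lerP c) => /= h.
  by rewrite mulr1 -[leRHS]real_normK ?num_real// ler_sqr ?nnegrE// ltW.
by rewrite mulr0 sqr_ge0.
Qed.

Lemma ex_var4 f1 f2 f3 f4 :
  ex_var E (fun x => f1 x - f2 x - f3 x + f4 x) <=
  4 * (ex_var E f1 + ex_var E f2 + ex_var E f3 + ex_var E f4).
Proof.
rewrite /ex_var exD !exB -!exD -exZ; apply: (ex_le hE) => x.
set a1 := E f1; set a2 := E f2; set a3 := E f3; set a4 := E f4.
pose y1 := f1 x - a1; pose y2 := f2 x - a2.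
pose y3 := f3 x - a3; pose y4 := f4 x - a4.
suff : (y1 - y2 - y3 + y4) ^+ 2 <= 4 * (y1 ^+ 2 + y2 ^+ 2 + y3 ^+ 2 + y4 ^+ 2).
  by apply: le_trans; rewrite le_eqVlt; apply/orP; left; apply/eqP; rewrite /y1 /y2 /y3 /y4; ring.
rewrite -subr_ge0.
have -> : 4 * (y1 ^+ 2 + y2 ^+ 2 + y3 ^+ 2 + y4 ^+ 2) - (y1 - y2 - y3 + y4) ^+ 2 =
  (y1 + y2) ^+ 2 + (y1 + y3) ^+ 2 + (y1 - y4) ^+ 2 + (y2 - y3) ^+ 2
   + (y2 + y4) ^+ 2 + (y3 + y4) ^+ 2 by ring.
by rewrite !addr_ge0// sqr_ge0.
Qed.

End Theory.

Lemma supported_true T (E : (T -> R) -> R) : is_expectation E -> supported E (fun=> True).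
Proof. by move=> hE f g fg; apply: (ex_le hE) => x; exact: fg. Qed.

(** * Independent coordinates *)

Definition coin (q : R) (f : bool -> R) : R := q * f true + (1 - q) * f false.

Definition indep (S T : Type) (D : (S -> R) -> R) (E : (T -> R) -> R)
    (f : S * T -> R) : R := D (fun x => E (fun y => f (x, y))).

Fixpoint iid (T : Type) (D : (T -> R) -> R) (n : nat) (f : seq T -> R) : R :=
  if n is n'.+1 then D (fun x => iid D n' (fun s => f (x :: s))) else f [::].

Lemma coin_expectation q : 0 <= q <= 1 -> is_expectation (coin q).
Proof.
move=> /andP[q0 q1]; split=> [c f g|f g fg|]; rewrite /coin; [ring| |ring].
by apply: lerD; apply: ler_wpM2l => //; lra.
Qed.

Lemma coin_exchange T (E : (T -> R) -> R) q f : is_expectation E ->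
  coin q (fun x => E (f x)) = E (fun y => coin q (f^~ y)).
Proof. by move=> hE; rewrite /coin exD// !exZ. Qed.

Lemma indep_expectation S T (D : (S -> R) -> R) (E : (T -> R) -> R) :
  is_expectation D -> is_expectation E -> is_expectation (indep D E).
Proof.
move=> hD hE; split=> [c f g|f g fg|]; rewrite /indep.
- by rewrite -(ex_linear hD); apply: eq_ex => x; exact: ex_linear.
- by apply: (ex_le hD) => x; exact: (ex_le hE).
- by rewrite (ex_one hE) (ex_one hD).
Qed.

Lemma indep_supported S T (D : (S -> R) -> R) (E : (T -> R) -> R) (P : S -> Prop)
    (Q : T -> Prop) : supported D P -> supported E Q ->
  supported (indep D E) (fun z => P z.1 /\ Q z.2).
Proof. by move=> hD hE f g fg; apply: hD => x Px; apply: hE => y Qy; exact: fg. Qed.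

Lemma indep_mul S T (D : (S -> R) -> R) (E : (T -> R) -> R) f g :
  is_expectation D -> is_expectation E -> indep D E (fun z => f z.1 * g z.2) = D f * E g.
Proof.
move=> hD hE; rewrite /indep; transitivity (D (fun x => E g * f x)).
  by apply: eq_ex => x /=; rewrite exZ// mulrC.
by rewrite exZ// mulrC.
Qed.

Lemma indep_fst S T (D : (S -> R) -> R) (E : (T -> R) -> R) f :
  is_expectation E -> indep D E (fun z => f z.1) = D f.
Proof. by move=> hE; rewrite /indep; apply: eq_ex => x; exact: (ex_cst hE (f x)). Qed.

Lemma indep_snd S T (D : (S -> R) -> R) (E : (T -> R) -> R) f :
  is_expectation D -> indep D E (fun z => f z.2) = E f.
Proof. by move=> hD; exact: (ex_cst hD (E f)). Qed.

Section Iid.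
Variables (T : Type) (D : (T -> R) -> R).
Hypothesis hD : is_expectation D.

Lemma iid_expectation n : is_expectation (iid D n).
Proof.
elim: n => [|n IH]; first by split=> // f g; exact.
by split=> [c f g|f g fg|] /=;
  [rewrite -(ex_linear hD); apply: eq_ex => x; exact: ex_linear
  |apply: (ex_le hD) => x; exact: (ex_le IH)|rewrite (ex_one IH) (ex_one hD)].
Qed.

Lemma iid_supported (Q : pred T) n : supported D Q ->
  supported (iid D n) (fun s => size s = n /\ all Q s).
Proof.
move=> sD; elim: n => [|n IH] f g fg /=; first exact: fg.
by apply: sD => x Qx; apply: IH => s [ss Qs]; apply: fg; rewrite /= ss Qx.
Qed.

Lemma iid_size n : supported (iid D n) (fun s => size s = n).
Proof.
move=> f g fg; apply: (@iid_supported predT) => [|s []]; last by move=> ? _; exact: fg.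
by move=> ? ? h; apply: (ex_le hD) => x; exact: h.
Qed.

Lemma iid_nth (x0 : T) (h : T -> R) n i : (i < n)%N ->
  iid D n (fun s => h (nth x0 s i)) = D h.
Proof.
elim: n i => [//|n IH] [_|i /= /IH IHi] /=.
  by apply: eq_ex => x; rewrite ex_cst//; exact: iid_expectation.
by rewrite -[RHS](ex_cst hD); apply: eq_ex => x.
Qed.

Lemma iid_cat k l f :
  iid D (k + l) f = iid D k (fun s => iid D l (fun t => f (s ++ t))).
Proof. by elim: k f => [//|k IH] f /=; apply: eq_ex => x; rewrite IH. Qed.

Lemma iid_map S (D' : (S -> R) -> R) (g : T -> S) n f :
  (forall f, D (fun x => f (g x)) = D' f) ->
  iid D n (fun s => f (map g s)) = iid D' n f.
Proof.
by move=> DD'; elim: n f => [//|n IH] f /=; rewrite -DD'; apply: eq_ex => x; rewrite -IH.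
Qed.

(* Discrete integration by parts: for a Bernoulli(q) coordinate, read off by [h + q] and
   resampled to 1 and 0 by [s1] and [s0], the hypothesis holds with [k = q (1 - q)]. *)
Lemma iid_by_parts (x0 : T) (h : T -> R) (s1 s0 : T -> T) (k : R) :
  (forall f, D (fun x => h x * f x) = k * D (fun x => f (s1 x) - f (s0 x))) ->
  forall n i f, (i < n)%N ->
  iid D n (fun s => h (nth x0 s i) * f s) =
  k * iid D n (fun s => f (set_nth x0 s i (s1 (nth x0 s i)))
                       - f (set_nth x0 s i (s0 (nth x0 s i)))).
Proof.
move=> hk; elim=> [//|n IH] [|i] f /=.
  move=> _; have hI := iid_expectation n.
  transitivity (D (fun x => h x * iid D n (fun s => f (x :: s)))).
    by apply: eq_ex => x; rewrite -exZ.
  by rewrite hk; congr (_ * _); apply: eq_ex => x; rewrite exB.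
by rewrite ltnS => /IH IHi; rewrite -exZ//; apply: eq_ex => x; rewrite IHi.
Qed.

(** Integration by parts is applied to each summand against the whole sum; resampling one coordinate
    changes the sum by exactly 1, so each summand contributes [k]. *)
Lemma iid_sum_var (x0 : T) (h : T -> R) (s1 s0 : T -> T) (k : R) :
  (forall f, D (fun x => h x * f x) = k * D (fun x => f (s1 x) - f (s0 x))) ->
  (forall x, h (s1 x) - h (s0 x) = 1) ->
  forall n l, (l <= n)%N ->
  iid D n (fun s => (\sum_(i < l) h (nth x0 s i)) ^+ 2) = l%:R * k.
Proof.
move=> hk h1 n l ln; have hI := iid_expectation n.
transitivity (\sum_(i < l) iid D n
    (fun s => h (nth x0 s i) * \sum_(j < l) h (nth x0 s j))).
  by rewrite -ex_sum//; apply: eq_ex => s; rewrite expr2 mulr_suml.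
transitivity (\sum_(i < l) k); last by rewrite sumr_const card_ord mulr_natl.
apply: eq_bigr => i _.
rewrite (@iid_by_parts x0 h s1 s0 k hk n i (fun s => \sum_(j < l) h (nth x0 s j)));
  last exact: leq_trans ln.
rewrite (_ : (fun s => _) = (fun=> 1)) ?ex_cst ?mulr1//.
apply/funext => s; rewrite -sumrB (bigD1 i)//= !nth_set_nth /= eqxx h1.
by rewrite big1 ?addr0// => j ji; rewrite !nth_set_nth /= val_eqE (negbTE ji) subrr.
Qed.

End Iid.

Lemma indep_map (S S' T T' : Type) (D : (S -> R) -> R) (D' : (S' -> R) -> R)
    (E : (T -> R) -> R) (E' : (T' -> R) -> R) (g : S -> S') (k : T -> T') f :
  (forall f, D (fun x => f (g x)) = D' f) ->
  (forall f, E (fun x => f (k x)) = E' f) ->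
  indep D E (fun z => f (g z.1, k z.2)) = indep D' E' f.
Proof. by move=> hD hE; rewrite /indep -hD; apply: eq_ex => x /=; rewrite -hE. Qed.

Lemma coin_by_parts q f :
  coin q (fun x => (x%:R - q) * f x) = q * (1 - q) * coin q (fun=> f true - f false).
Proof. rewrite /coin /=; ring. Qed.

(** Cauchy-Schwarz for the likelihood ratio of Ber(w) to Ber(u). The factor is the second moment of
    that ratio, one plus the chi-square distance; the defect is an explicit square. *)
Lemma coin_change (u w : R) (g : bool -> R) : 0 < u < 1 ->
  (coin w g) ^+ 2 <= (1 + (w - u) ^+ 2 / (u * (1 - u))) * coin u (fun x => g x ^+ 2).
Proof.
move=> /andP[u0 u1]; rewrite /coin -subr_ge0.
set a := g true; set b := g false.
have -> : (1 + (w - u) ^+ 2 / (u * (1 - u))) * (u * a ^+ 2 + (1 - u) * b ^+ 2)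
    - (w * a + (1 - w) * b) ^+ 2 =
  (w * (1 - u) * b - (1 - w) * u * a) ^+ 2 / (u * (1 - u)).
  by field; apply/andP; split; lra.
by rewrite divr_ge0 ?sqr_ge0// mulr_ge0; lra.
Qed.

Lemma iid_coin_change (u w : R) (n : nat) (g : seq bool -> R) : 0 < u < 1 -> 0 <= w <= 1 ->
  (iid (coin w) n g) ^+ 2 <=
  (1 + (w - u) ^+ 2 / (u * (1 - u))) ^+ n * iid (coin u) n (fun s => g s ^+ 2).
Proof.
move=> hu hw; have cu : is_expectation (coin u) by apply: coin_expectation; lra.
set M := 1 + _; have M0 : 0 <= M.
  by rewrite addr_ge0// divr_ge0 ?sqr_ge0// mulr_ge0; lra.
elim: n g => [|n IH] g /=; first by rewrite mul1r.
apply: le_trans (coin_change _ _ hu) _; rewrite -/M exprS -mulrA ler_wpM2l//.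
by rewrite -exZ//; apply: (ex_le cu) => x; exact: IH.
Qed.

End Expectation.

(** * The Burke property *)

Section Burke.
Variable R : realType.

Definition passage (m n : nat) (w : site -> bool) : R := (lpp w m n)%:R.

Definition vparam (p u : R) : R := p * (1 - u) / (u + p * (1 - u)).

Definition env_law (p qa qb : R) (m n : nat) : (env -> R) -> R :=
  indep (iid (coin qa) m) (iid (indep (coin qb) (iid (coin p) m)) n).

Definition stat (p u : R) : nat -> nat -> (env -> R) -> R := env_law p u (vparam p u).

Lemma row_expectation (p q : R) m : 0 <= p <= 1 -> 0 <= q <= 1 ->
  is_expectation (indep (coin q) (iid (coin p) m)).
Proof.
move=> hp hq; apply: indep_expectation; first exact: coin_expectation.
by apply: iid_expectation; exact: coin_expectation.
Qed.

Lemma env_law_expectation (p qa qb : R) m n :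
  0 <= p <= 1 -> 0 <= qa <= 1 -> 0 <= qb <= 1 -> is_expectation (env_law p qa qb m n).
Proof.
move=> hp ha hb; apply: indep_expectation; apply: iid_expectation.
  exact: coin_expectation.
exact: row_expectation.
Qed.

Lemma env_law_supported (p qa qb : R) m n :
  0 <= p <= 1 -> 0 <= qa <= 1 -> 0 <= qb <= 1 ->
  supported (env_law p qa qb m n) (env_size m n).
Proof.
move=> hp ha hb.
have ca := coin_expectation ha; have cb := coin_expectation hb.
have cp := coin_expectation hp.
have h := @indep_supported R _ _ (iid (coin qa) m) _ _ _ (iid_size ca (n := m))
  (@iid_supported R _ (indep (coin qb) (iid (coin p) m)) (fun r => size r.2 == m) n _).
move=> f g fg; apply: h => [|[a rows] [/= sa [sr ar]]]; last by apply: fg; split.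
move=> f' g' fg'.
have := indep_supported (supported_true cb) (iid_size cp (n := m)); apply.
by move=> [b o] [_ /= so]; apply: fg'; rewrite /= so.
Qed.

Section Stationary.
Variables (p u : R).
Hypotheses (hp : 0 < p < 1) (hu : 0 < u < 1).
Local Notation v := (vparam p u).

Lemma vparam_denom : 0 < u + p * (1 - u).
Proof. by move: hp hu => *; rewrite addr_gt0 ?mulr_gt0//; lra. Qed.

Lemma vparam_itv : 0 < v < 1.
Proof.
have d0 := vparam_denom; move: hp hu => *; rewrite /vparam; apply/andP; split.
  by rewrite divr_gt0 ?mulr_gt0//; lra.
by rewrite ltr_pdivrMr//; lra.
Qed.

Let p01 : 0 <= p <= 1. Proof. move: hp; lra. Qed.
Let u01 : 0 <= u <= 1. Proof. move: hu; lra. Qed.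
Let v01 : 0 <= v <= 1. Proof. by have := vparam_itv; lra. Qed.
Let cp := coin_expectation p01.
Let cu := coin_expectation u01.
Let cv := coin_expectation v01.

(** Both outputs are 1 only for [x = b = 0] and [y = 1], so their independence demands
    [(1 - u) * (1 - v) * p = u * v]. This equation is the origin of [vparam]. *)
Lemma burke_cell (f : bool -> bool -> R) :
  coin u (fun x => coin v (fun b => coin p (fun y =>
    f (~~ b && (x || y)) (~~ x && (b || y))))) =
  coin u (fun x => coin v (fun b => f x b)).
Proof.
have d0 := vparam_denom.
by rewrite /coin /vparam /=; field; rewrite gt_eqF.
Qed.

Lemma burke_row m (F : seq bool -> bool -> R) :
  iid (coin u) m (fun a => coin v (fun b => iid (coin p) m (fun o =>
    F (cross_row a b o).1 (cross_row a b o).2))) =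
  iid (coin u) m (fun a => coin v (fun b => F a b)).
Proof.
elim: m F => [//|m IH] F /=.
(* [phi i j] averages over the rest of the row when the first cell has north increment [i] and east
   increment [j]; the latter enters the next cell from the west. *)
pose phi i j := iid (coin u) m (fun a => iid (coin p) m (fun o =>
  F (i :: (cross_row a j o).1) (cross_row a j o).2)).
have hI := iid_expectation cu m.
transitivity (coin u (fun x => coin v (fun b => coin p (fun y =>
    phi (~~ b && (x || y)) (~~ x && (b || y)))))).
  apply: eq_ex => x; rewrite -coin_exchange//; apply: eq_ex => b.
  by rewrite -coin_exchange.
rewrite burke_cell; apply: eq_ex => x.
by rewrite /phi coin_exchange// -(IH (fun a b => F (x :: a) b)).
Qed.

Lemma burke m n (F : seq bool * seq bool -> R) :
  stat p u m n (fun e => F (cross e.1 e.2)) = indep (iid (coin u) m) (iid (coin v) n) F.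
Proof.
rewrite /stat /env_law /indep /=.
elim: n F => [//|n IH] F /=.
have hI := iid_expectation cu m.
have hr := iid_expectation (row_expectation m p01 v01) n.
rewrite (@burke_row m (fun a b => iid (indep (coin v) (iid (coin p) m)) n
  (fun rows => F ((cross a rows).1, b :: (cross a rows).2)))).
transitivity (coin v (fun b => iid (coin u) m (fun a =>
   iid (indep (coin v) (iid (coin p) m)) n
     (fun rows => F ((cross a rows).1, b :: (cross a rows).2))))).
  by rewrite coin_exchange.
rewrite -(coin_exchange v _ hI); apply: eq_ex => b.
exact: (IH (fun z => F (z.1, b :: z.2))).
Qed.

(** * The variance identity *)

Let hE m n : is_expectation (stat p u m n).
Proof. exact: env_law_expectation. Qed.

Let hS m n : supported (stat p u m n) (env_size m n).
Proof. exact: env_law_supported. Qed.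

Let hrow m : is_expectation (indep (coin v) (iid (coin p) m)).
Proof. exact: row_expectation. Qed.

Lemma coin_centered (q : R) : coin q (fun x => x%:R - q) = 0.
Proof. rewrite /coin /=; ring. Qed.

Lemma row_by_parts m f :
  indep (coin v) (iid (coin p) m) (fun r => (r.1%:R - v) * f r) =
  v * (1 - v) * indep (coin v) (iid (coin p) m) (fun r => f (true, r.2) - f (false, r.2)).
Proof.
have hI := iid_expectation cp m; rewrite /indep /=.
transitivity (coin v (fun b => (b%:R - v) * iid (coin p) m (fun o => f (b, o)))).
  by apply: eq_ex => b; rewrite -exZ.
by rewrite coin_by_parts; congr (_ * _); apply: eq_ex => b; rewrite exB.
Qed.

(** This and the next three definitions are the centered increment sums along the south, west, north
    and east sides; the last two are read off the output of [cross]. *)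
Definition hbar (k : nat) (e : env) : R := \sum_(i < k) ((nth false e.1 i)%:R - u).
Definition vbar (k : nat) (e : env) : R :=
  \sum_(j < k) ((nth (false, [::]) e.2 j).1%:R - v).
Definition cross_hbar (k : nat) (z : seq bool * seq bool) : R :=
  \sum_(i < k) ((nth false z.1 i)%:R - u).
Definition cross_vbar (k : nat) (z : seq bool * seq bool) : R :=
  \sum_(j < k) ((nth false z.2 j)%:R - v).

Lemma centered_sum (I : finType) (b : I -> bool) (q : R) :
  \sum_i ((b i)%:R - q) = (\sum_i b i)%:R - #|I|%:R * q.
Proof. by rewrite sumrB sumr_const -natr_sum mulr_natl. Qed.

Lemma passage_vh m n e : env_size m n e ->
  passage m n (wt e) = vbar n e + cross_hbar m (cross e.1 e.2) + (m%:R * u + n%:R * v).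
Proof.
move=> es; rewrite (cross_env es) /vbar /cross_hbar !centered_sum !card_ord.
rewrite /passage lpp_hsum lpp0j natrD !big_mkord.
rewrite (eq_bigr (fun i : 'I_m => nth false [seq hinc (wt e) t n | t <- iota 0 m] i : nat)).
  ring.
by move=> i _; rewrite (nth_map 0) ?size_iota// nth_iota.
Qed.

Lemma passage_hv m n e : env_size m n e ->
  passage m n (wt e) = hbar m e + cross_vbar n (cross e.1 e.2) + (m%:R * u + n%:R * v).
Proof.
move=> es; rewrite (cross_env es) /hbar /cross_vbar !centered_sum !card_ord.
rewrite /passage lpp_vsum lppi0 natrD !big_mkord.
rewrite [X in _ + X%:R](eq_bigr
  (fun i : 'I_n => nth false [seq vinc (wt e) m t | t <- iota 0 n] i : nat)).
  ring.
by move=> i _; rewrite (nth_map 0) ?size_iota// nth_iota.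
Qed.

Lemma iid_centered_sum (T : Type) (D : (T -> R) -> R) (x0 : T) (h : T -> R) n k :
  is_expectation D -> D h = 0 -> (k <= n)%N ->
  iid D n (fun s => \sum_(i < k) h (nth x0 s i)) = 0.
Proof.
move=> hD h0 kn; rewrite ex_sum; last exact: iid_expectation.
by apply: big1 => i _; rewrite iid_nth// (leq_trans _ kn).
Qed.

Lemma mean_hbar m n k : (k <= m)%N -> stat p u m n (hbar k) = 0.
Proof.
move=> km; rewrite -(iid_centered_sum false cu (coin_centered u) km).
exact: (indep_fst _ (fun a => \sum_(i < k) _) (iid_expectation (hrow m) n)).
Qed.

Lemma mean_row_centered m : indep (coin v) (iid (coin p) m) (fun r => r.1%:R - v) = 0.
Proof.
rewrite -(coin_centered v).
exact: (indep_fst _ (fun b : bool => b%:R - v) (iid_expectation cp m)).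
Qed.

Lemma mean_rows_vbar m n :
  iid (indep (coin v) (iid (coin p) m)) n
    (fun s => \sum_(i < n) ((nth (false, [::]) s i).1%:R - v)) = 0.
Proof. exact: (iid_centered_sum _ (hrow m) (mean_row_centered m)). Qed.

Lemma mean_vbar m n : stat p u m n (vbar n) = 0.
Proof.
rewrite -(mean_rows_vbar m n).
exact: (indep_snd _ (fun s => \sum_(j < n) _) (iid_expectation cu m)).
Qed.

Lemma mean_hbar_vbar m n : stat p u m n (fun e => hbar m e * vbar n e) = 0.
Proof.
have ha := iid_expectation cu m; have hr := iid_expectation (hrow m) n.
transitivity (iid (coin u) m (fun a => \sum_(i < m) ((nth false a i)%:R - u)) *
  iid (indep (coin v) (iid (coin p) m)) n
    (fun s => \sum_(i < n) ((nth (false, [::]) s i).1%:R - v))).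
  exact: (indep_mul (fun a => \sum_(i < m) _) (fun s => \sum_(i < n) _) ha hr).
by rewrite mean_rows_vbar mulr0.
Qed.

Lemma mean_hbar2 m n k : (k <= m)%N ->
  stat p u m n (fun e => hbar k e ^+ 2) = k%:R * (u * (1 - u)).
Proof.
move=> km; rewrite -(iid_sum_var cu false (s1 := fun=> true) (s0 := fun=> false)
  (coin_by_parts u) _ km); last by move=> _ /=; ring.
exact: (indep_fst _ (fun a => (\sum_(i < k) _) ^+ 2) (iid_expectation (hrow m) n)).
Qed.

Lemma mean_vbar2 m n :
  stat p u m n (fun e => vbar n e ^+ 2) = n%:R * (v * (1 - v)).
Proof.
rewrite -(iid_sum_var (hrow m) (false, [::]) (h := fun r => r.1%:R - v)
  (s1 := fun r => (true, r.2)) (s0 := fun r => (false, r.2)) (@row_by_parts m) _ (leqnn n)).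
  exact: (indep_snd _ (fun s => (\sum_(j < n) _) ^+ 2) (iid_expectation cu m)).
by move=> r /=; ring.
Qed.

Lemma mean_cross_hbar2 m n :
  stat p u m n (fun e => cross_hbar m (cross e.1 e.2) ^+ 2) = m%:R * (u * (1 - u)).
Proof.
rewrite (burke m n (fun z => cross_hbar m z ^+ 2)).
rewrite -(iid_sum_var cu false (s1 := fun=> true) (s0 := fun=> false)
  (coin_by_parts u) _ (leqnn m)); last by move=> _ /=; ring.
exact: (indep_fst _ (fun a => (\sum_(i < m) _) ^+ 2) (iid_expectation cv n)).
Qed.

Lemma mean_cross_hbar m n : stat p u m n (fun e => cross_hbar m (cross e.1 e.2)) = 0.
Proof.
rewrite (burke m n (cross_hbar m)).
rewrite -(iid_centered_sum false cu (coin_centered u) (leqnn m)).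
exact: (indep_fst _ (fun a => \sum_(i < m) _) (iid_expectation cv n)).
Qed.

Lemma mean_cross_hbar_vbar m n :
  stat p u m n (fun e => cross_hbar m (cross e.1 e.2) * cross_vbar n (cross e.1 e.2)) = 0.
Proof.
rewrite (burke m n (fun z => cross_hbar m z * cross_vbar n z)).
rewrite (indep_mul (fun a => \sum_(i < m) ((nth false a i)%:R - u))
  (fun s => \sum_(i < n) ((nth false s i)%:R - v))).
- by rewrite (iid_centered_sum false cv (coin_centered v) (leqnn n)) mulr0.
- exact: iid_expectation.
- exact: iid_expectation.
Qed.

Lemma mean_passage m n :
  stat p u m n (fun e => passage m n (wt e)) = m%:R * u + n%:R * v.
Proof.
rewrite (supported_eq (@hS m n) (@passage_vh m n)) !exD// mean_vbar mean_cross_hbar.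
by rewrite !ex_cst//; ring.
Qed.

Definition hcov m n : R := stat p u m n (fun e => hbar m e * passage m n (wt e)).
Definition vcov m n : R := stat p u m n (fun e => vbar n e * passage m n (wt e)).

(* [W + N = S + E] for the centered west, north, south and east increment sums. Since
   [S] is independent of [W] and [N] of [E], expanding [Var (W + N)] as
   [Cov (S + E, W + N)] leaves [Cov (S, N) + Cov (E, W)]. *)
Lemma ex_var_cov m n :
  ex_var (stat p u m n) (fun e => passage m n (wt e)) = hcov m n + vcov m n /\
  hcov m n - vcov m n = m%:R * (u * (1 - u)) - n%:R * (v * (1 - v)).
Proof.
pose M := m%:R * u + n%:R * v.
pose S := hbar m; pose W := vbar n.
pose N (e : env) := cross_hbar m (cross e.1 e.2).
pose E (e : env) := cross_vbar n (cross e.1 e.2).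
pose X := stat p u m n; have hX : is_expectation X by exact: hE.
have sX : supported X (env_size m n) by exact: hS.
have swne e : env_size m n e -> S e + E e = W e + N e.
  move=> es; have h1 : passage m n (wt e) = W e + N e + M := passage_vh es.
  have h2 : passage m n (wt e) = S e + E e + M := passage_hv es.
  by apply: (addIr M); rewrite -h1 -h2.
have XS : X S = 0 by exact: mean_hbar.
have XW : X W = 0 by exact: mean_vbar.
have XSW : X (fun e => S e * W e) = 0 by exact: mean_hbar_vbar.
have XNE : X (fun e => N e * E e) = 0 by exact: mean_cross_hbar_vbar.
have XN2 : X (fun e => N e ^+ 2) = m%:R * (u * (1 - u)) by exact: mean_cross_hbar2.
have XW2 : X (fun e => W e ^+ 2) = n%:R * (v * (1 - v)) by exact: mean_vbar2.
have hcovE : hcov m n = X (fun e => S e * N e).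
  rewrite /hcov -/X -/S.
  transitivity (X (fun e => S e * W e + S e * N e + M * S e)).
    by apply: (supported_eq sX) => e es; rewrite (passage_vh es) -/W -/(N e) -/M; ring.
  by rewrite !exD// exZ// XSW XS; ring.
have vcovE : vcov m n = X (fun e => E e * W e).
  rewrite /vcov -/X -/W.
  transitivity (X (fun e => S e * W e + E e * W e + M * W e)).
    by apply: (supported_eq sX) => e es; rewrite (passage_hv es) -/S -/(E e) -/M; ring.
  by rewrite !exD// exZ// XSW XW; ring.
rewrite hcovE vcovE; split.
  rewrite /ex_var mean_passage -/X -/M.
  transitivity (X (fun e => S e * W e + S e * N e + E e * W e + N e * E e)).
    apply: (supported_eq sX) => e es; rewrite (passage_vh es) -/W -/(N e) -/M.
    have -> : W e + N e + M - M = W e + N e by ring.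
    by rewrite expr2 -{1}(swne e es); ring.
  by rewrite !exD// XSW XNE; ring.
have XWN : X (fun e => W e * N e) = X (fun e => E e * W e) - n%:R * (v * (1 - v)).
  rewrite -XW2 -exB//.
  transitivity (X (fun e => S e * W e + (E e * W e - W e ^+ 2))).
    apply: (supported_eq sX) => e es; have -> : N e = S e + E e - W e by rewrite swne//; ring.
    ring.
  by rewrite exD// XSW add0r.
have : X (fun e => N e ^+ 2) = X (fun e => S e * N e + N e * E e - W e * N e).
  apply: (supported_eq sX) => e es.
  by rewrite expr2 -{1}[N e](addKr (W e)) -(swne e es); ring.
by rewrite exB// exD// XNE XWN XN2 => ->; ring.
Qed.

Definition hgain m n i (e : env) : R :=
  passage m n (upd (wt e) (i.+1, 0)%N true) - passage m n (upd (wt e) (i.+1, 0)%N false).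
Definition vgain m n j (e : env) : R :=
  passage m n (upd (wt e) (0, j.+1)%N true) - passage m n (upd (wt e) (0, j.+1)%N false).

Lemma hcov_gain m n : hcov m n = u * (1 - u) * \sum_(i < m) stat p u m n (hgain m n i).
Proof.
have hr := iid_expectation (hrow m) n; have hI := iid_expectation cu m.
transitivity (\sum_(i < m) stat p u m n
  (fun e => ((nth false e.1 i)%:R - u) * passage m n (wt e))).
  by rewrite -ex_sum//; apply: eq_ex => e; rewrite mulr_suml.
rewrite mulr_sumr; apply: eq_bigr => i _; rewrite /stat /env_law /indep /=.
transitivity (iid (coin u) m (fun a => ((nth false a i)%:R - u) *
  iid (indep (coin v) (iid (coin p) m)) n (fun rows => passage m n (wt (a, rows))))).
  by apply: eq_ex => a; rewrite -exZ.
rewrite (iid_by_parts cu false (s1 := fun=> true) (s0 := fun=> false)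
  (h := fun x => x%:R - u) (coin_by_parts u) _ (ltn_ord i)).
congr (_ * _); apply: eq_ex => a; rewrite -exB//; apply: eq_ex => rows.
by rewrite /hgain -!(wt_hset (a, rows)).
Qed.

Lemma vcov_gain m n : vcov m n = v * (1 - v) * \sum_(j < n) stat p u m n (vgain m n j).
Proof.
have hr := iid_expectation (hrow m) n; have hI := iid_expectation cu m.
transitivity (\sum_(j < n) stat p u m n
  (fun e => ((nth (false, [::]) e.2 j).1%:R - v) * passage m n (wt e))).
  by rewrite -ex_sum//; apply: eq_ex => e; rewrite mulr_suml.
rewrite mulr_sumr; apply: eq_bigr => j _; rewrite /stat /env_law /indep /= -exZ//.
apply: eq_ex => a.
rewrite (iid_by_parts (hrow m) (false, [::]) (h := fun r => r.1%:R - v)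
  (s1 := fun r => (true, r.2)) (s0 := fun r => (false, r.2)) (@row_by_parts m)
  (fun rows => passage m n (wt (a, rows))) (ltn_ord j)).
congr (_ * _); apply: eq_ex => rows.
by rewrite /vgain -!(wt_vset (a, rows)).
Qed.

End Stationary.
End Burke.

(** * Coupling two stationary environments *)

Section Coupling.
Variable R : realType.

(* A pair [(x, y)] of independent bits encodes the coupled bits [x <= x || y]: [x] is the
   smaller one, used at [u] on the horizontal axis and at [w] on the vertical axis. *)
Definition coupled : Type := (seq (bool * bool) * seq ((bool * bool) * seq bool))%type.

Definition lo_env (z : coupled) : env :=
  (map fst z.1, [seq (r.1.1 || r.1.2, r.2) | r <- z.2]).
Definition hi_env (z : coupled) : env :=
  ([seq x.1 || x.2 | x <- z.1], [seq (r.1.1, r.2) | r <- z.2]).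
(** Only the first [k] horizontal bits are raised. The vertical axis stays that of [lo_env], which
    is the larger one, so a path of [hi_env] that exits early loses nothing here. *)
Definition mid_env (k : nat) (z : coupled) : env :=
  (take k (hi_env z).1 ++ drop k (lo_env z).1, (lo_env z).2).

Lemma wt_lo_hi_horizontal z t : wt (lo_env z) (t.+1, 0)%N -> wt (hi_env z) (t.+1, 0)%N.
Proof. by rewrite /=; elim: z.1 t => [|[x y] s IH] [|t] //=; [move->|exact: IH]. Qed.

Lemma wt_hi_lo_vertical z t : wt (hi_env z) (0, t.+1)%N -> wt (lo_env z) (0, t.+1)%N.
Proof. by rewrite /=; elim: z.2 t => [|[[x y] o] s IH] [|t] //=; [move->|exact: IH]. Qed.

Lemma wt_lo_hi_bulk z i j : wt (lo_env z) (i.+1, j.+1)%N = wt (hi_env z) (i.+1, j.+1)%N.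
Proof. by rewrite /=; elim: z.2 j => [|[[x y] o] s IH] [|j] //=; exact: IH. Qed.

Lemma wt_mid_horizontal k z t : (t < k)%N ->
  wt (mid_env k z) (t.+1, 0)%N = wt (hi_env z) (t.+1, 0)%N.
Proof.
move=> tk; rewrite /=; have [zt|tz] := leqP (size z.1) t.
  by rewrite !nth_default// ?size_cat ?size_take_min ?size_drop ?size_map//; lia.
by rewrite nth_cat size_take_min size_map leq_min tk tz nth_take.
Qed.

Lemma ex_var_map S T (E : (T -> R) -> R) (E' : (S -> R) -> R) (g : T -> S) f :
  (forall f, E (fun x => f (g x)) = E' f) ->
  ex_var E (fun x => f (g x)) = ex_var E' f.
Proof. by move=> h; rewrite /ex_var h -(h (fun y => (f y - E' f) ^+ 2)). Qed.

Lemma sqr_ex_le T (E : (T -> R) -> R) f : is_expectation E -> E f ^+ 2 <= E (fun x => f x ^+ 2).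
Proof.
move=> hE; rewrite -subr_ge0; have := ex_var_ge0 hE f; rewrite /ex_var.
have -> : (fun x => (f x - E f) ^+ 2) =
    (fun x => f x ^+ 2 - (2 * E f) * f x + E f ^+ 2) by apply/funext => x; ring.
by rewrite exD// exB// exZ// ex_cst//; congr (_ <= _); ring.
Qed.

Definition hcount (k : nat) (e : env) : R := (\sum_(0 <= t < k) wt e (t.+1, 0)%N)%:R.

Lemma hcount_hbar u k e : hcount k e = hbar u k e + k%:R * u.
Proof. by rewrite /hbar centered_sum card_ord /hcount big_mkord subrK. Qed.

Section Law.
Variables (p u w : R).
Hypotheses (hp : 0 < p < 1) (hu : 0 < u < 1) (hw : 0 < w < 1) (uw : u < w).
Local Notation vu := (vparam p u).
Local Notation vw := (vparam p w).

Lemma vparamB : vw - vu = - (p * (w - u) / ((u + p * (1 - u)) * (w + p * (1 - w)))).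
Proof.
have := vparam_denom hp hu; have := vparam_denom hp hw => dw du; rewrite /vparam.
by field; rewrite !gt_eqF.
Qed.

Lemma vparam_lt : vw < vu.
Proof.
rewrite -subr_lt0 vparamB oppr_lt0 divr_gt0 ?mulr_gt0 ?vparam_denom ?subr_gt0//.
by case/andP: hp.
Qed.

Let hvu : 0 < vu < 1. Proof. exact: vparam_itv. Qed.
Let hvw : 0 < vw < 1. Proof. exact: vparam_itv. Qed.

(** Solutions of [(1 - u) * (1 - c) = 1 - w] and [(1 - vw) * (1 - d) = 1 - vu], which give the
    disjunction of the two bits of a pair the larger parameter. *)
Let c := (w - u) / (1 - u).
Let d := (vu - vw) / (1 - vw).

Let hc : 0 <= c <= 1.
Proof.
move: hu hw uw => *; rewrite /c; apply/andP; split.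
  by rewrite divr_ge0; lra.
by rewrite ler_pdivrMr; lra.
Qed.

Let hd : 0 <= d <= 1.
Proof.
have := vparam_lt; move: hvu hvw => *; rewrite /d; apply/andP; split.
  by rewrite divr_ge0; lra.
by rewrite ler_pdivrMr; lra.
Qed.

Let p01 : 0 <= p <= 1. Proof. move: hp; lra. Qed.
Let u01 : 0 <= u <= 1. Proof. move: hu; lra. Qed.
Let w01 : 0 <= w <= 1. Proof. move: hw; lra. Qed.
Let vu01 : 0 <= vu <= 1. Proof. move: hvu; lra. Qed.
Let vw01 : 0 <= vw <= 1. Proof. move: hvw; lra. Qed.
Let cp := coin_expectation p01.

Definition coupling (m n : nat) : (coupled -> R) -> R :=
  indep (iid (indep (coin u) (coin c)) m)
        (iid (indep (indep (coin vw) (coin d)) (iid (coin p) m)) n).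

Let hA : is_expectation (indep (coin u) (coin c)).
Proof. by apply: indep_expectation; exact: coin_expectation. Qed.

Let hB m : is_expectation (indep (indep (coin vw) (coin d)) (iid (coin p) m)).
Proof.
apply: indep_expectation; last exact: iid_expectation.
by apply: indep_expectation; exact: coin_expectation.
Qed.

Lemma coupling_expectation m n : is_expectation (coupling m n).
Proof. by apply: indep_expectation; apply: iid_expectation. Qed.

Lemma coin_fst q r f : 0 <= r <= 1 -> indep (coin q) (coin r) (fun x => f x.1) = coin q f :> R.
Proof. by move=> hr; apply: indep_fst; exact: coin_expectation. Qed.

Lemma coin_or (q q' r : R) f : r * (1 - q) = q' - q ->
  indep (coin q) (coin r) (fun x => f (x.1 || x.2)) = coin q' f.
Proof.
rewrite /indep /coin /= => h; have -> : q' = q + r * (1 - q) by rewrite h; ring.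
ring.
Qed.

Let orA f : indep (coin u) (coin c) (fun x => f (x.1 || x.2)) = coin w f.
Proof. by apply: coin_or; rewrite /c divfK// gt_eqF//; move: hu; lra. Qed.

Let orB f : indep (coin vw) (coin d) (fun x => f (x.1 || x.2)) = coin vu f.
Proof. by apply: coin_or; rewrite /d divfK// gt_eqF//; move: hvw; lra. Qed.

Let rows_lo m n f :
  iid (indep (indep (coin vw) (coin d)) (iid (coin p) m)) n
    (fun s => f [seq (r.1.1 || r.1.2, r.2) | r <- s]) =
  iid (indep (coin vu) (iid (coin p) m)) n f :> R.
Proof.
apply: iid_map => g.
by rewrite -(@indep_map R _ _ _ _ (indep (coin vw) (coin d)) _ (iid (coin p) m) _
  (fun x => x.1 || x.2) id).
Qed.

Let rows_hi m n f :
  iid (indep (indep (coin vw) (coin d)) (iid (coin p) m)) n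
    (fun s => f [seq (r.1.1, r.2) | r <- s]) =
  iid (indep (coin vw) (iid (coin p) m)) n f :> R.
Proof.
apply: iid_map => g.
rewrite -(@indep_map R _ _ _ _ (indep (coin vw) (coin d)) _ (iid (coin p) m) _ fst id)// => h.
exact: coin_fst.
Qed.

Lemma coupling_lo m n f : coupling m n (fun z => f (lo_env z)) = stat p u m n f.
Proof.
apply: (@indep_map R _ _ _ _ _ _ _ _ (map fst)
  (map (fun r : (bool * bool) * seq bool => (r.1.1 || r.1.2, r.2)))) => g; last exact: rows_lo.
by apply: iid_map => h; exact: coin_fst.
Qed.

Lemma coupling_hi m n f : coupling m n (fun z => f (hi_env z)) = stat p w m n f.
Proof.
apply: (@indep_map R _ _ _ _ _ _ _ _ (map (fun x => x.1 || x.2))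
  (map (fun r : (bool * bool) * seq bool => (r.1.1, r.2)))) => g; last exact: rows_hi.
exact: iid_map.
Qed.

Lemma coupling_mid m n k f : (k <= m)%N ->
  coupling m n (fun z => f (mid_env k z)) =
  iid (coin w) k (fun a => iid (coin u) (m - k) (fun b =>
    iid (indep (coin vu) (iid (coin p) m)) n (fun rows => f (a ++ b, rows)))).
Proof.
move=> km; rewrite /coupling /indep /= -/(indep _ _) -[in LHS](subnKC km) iid_cat.
rewrite -(iid_map (D := indep (coin u) (coin c)) (g := fun x => x.1 || x.2) k _ orA).
apply: (supported_eq (iid_size hA (n := k))) => s sk.
rewrite -(iid_map (D := indep (coin u) (coin c)) (g := fst) (m - k)); last by move=> ?; exact: coin_fst.
apply: eq_ex => t; rewrite (subnKC km).
rewrite -rows_lo; apply: eq_ex => r; congr (f (_, _)).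
rewrite /mid_env /= !map_cat take_cat drop_cat !size_map sk ltnn subnn take0 drop0.
by rewrite cats0.
Qed.

(* Between [lo_env] and [mid_env k] only [k] coordinates change their law, which costs the
   [k]-th power of the chi-square factor. *)
Lemma coupling_mid_change m n k (A : env -> bool) : (k <= m)%N ->
  coupling m n (fun z => (A (mid_env k z))%:R) ^+ 2 <=
  (1 + (w - u) ^+ 2 / (u * (1 - u))) ^+ k * stat p u m n (fun e => (A e)%:R).
Proof.
move=> km; rewrite (coupling_mid n (fun e => (A e)%:R) km).
apply: le_trans (iid_coin_change _ _ hu w01) _; apply: ler_wpM2l.
  rewrite exprn_ge0// addr_ge0// divr_ge0 ?sqr_ge0//.
  by move: hu => *; rewrite mulr_ge0; lra.
have hku := coin_expectation u01.
have hI := iid_expectation hku.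
have hr : is_expectation (iid (indep (coin vu) (iid (coin p) m)) n).
  by apply: iid_expectation; exact: row_expectation.
rewrite /stat /env_law /indep /= -/(indep _ _) -[in leRHS](subnKC km) iid_cat (subnKC km).
apply: (ex_le (hI k)) => a; apply: le_trans (sqr_ex_le _ (hI (m - k)%N)) _.
apply: (ex_le (hI _)) => b; apply: le_trans (sqr_ex_le _ hr) _.
by apply: (ex_le hr) => rows; case: (A _); rewrite /= ?expr1n ?expr0n.
Qed.

(** Submodularity inside the coupling: [hi_env] has more horizontal and less vertical weight. This
    monotonicity brings the variance at [w] back to [u]. *)
Lemma vgain_le m n j : stat p w m n (vgain R m n j) <= stat p u m n (vgain R m n j).
Proof.
rewrite -coupling_lo -coupling_hi; apply: (ex_le (coupling_expectation m n)) => z.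
rewrite /vgain /passage lerBlDr addrAC lerBrDr -!natrD ler_nat.
by apply: lpp_vupd_submodular; [move=> i l; rewrite wt_lo_hi_bulk
 |exact: wt_lo_hi_horizontal|exact: wt_hi_lo_vertical].
Qed.

Lemma ex_var_hcount m n k q : (k <= m)%N -> 0 < q < 1 ->
  ex_var (stat p q m n) (hcount k) <= k%:R / 4.
Proof.
move=> km hq.
have hE : is_expectation (stat p q m n).
  by have := vparam_itv hp hq => ?; apply: env_law_expectation => //; lra.
have -> : hcount k = (fun e => hbar q k e + k%:R * q) by apply/funext => e; exact: hcount_hbar.
rewrite /ex_var exD// ex_cst// mean_hbar// add0r.
under eq_fun do rewrite addrK.
rewrite mean_hbar2// ler_wpM2l//.
have : 0 <= (q - 2^-1) ^+ 2 by exact: sqr_ge0.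
by rewrite expr2; lra.
Qed.

Lemma mean_hcount m n k q : (k <= m)%N -> 0 < q < 1 ->
  stat p q m n (hcount k) = k%:R * q.
Proof.
move=> km hq.
have hE : is_expectation (stat p q m n).
  by have := vparam_itv hp hq => ?; apply: env_law_expectation => //; lra.
have -> : hcount k = (fun e => hbar q k e + k%:R * q) by apply/funext => e; exact: hcount_hbar.
by rewrite exD// ex_cst// mean_hbar// add0r.
Qed.

(** * Exit probabilities and the tilted environment *)

Local Notation G m n := (fun e => passage R m n (wt e)).

(* Raising the horizontal parameter from [u] to [w] raises a path that stays on the axis up
   to [k] by at least the extra weight collected on the first [k] sites, which exceeds by
   [gap] what the mean passage time gains. *)
Lemma hexit_event_prob m n k (gap : R) : (0 < k <= m)%N -> 0 < gap ->
  gap <= k%:R * (w - u) - (m%:R * (w - u) + n%:R * (vw - vu)) - 1 ->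
  stat p u m n (fun e => (hexit_event (wt e) m n k)%:R) <=
  4 * (ex_var (stat p w m n) (G m n) + ex_var (stat p u m n) (G m n) + k%:R / 2)
    / gap ^+ 2.
Proof.
move=> /andP[k0 km] gap0 hgap; have hC := coupling_expectation m n.
(* On the exit event [X] is at least [-1] by [hexit_event_gap], while its mean is at most
   [- gap - 1]; so [X] deviates by at least [gap]. *)
pose X z := passage R m n (wt (hi_env z)) - passage R m n (wt (lo_env z))
  - hcount k (hi_env z) + hcount k (lo_env z).
have EX : coupling m n X = m%:R * (w - u) + n%:R * (vw - vu) - k%:R * (w - u).
  rewrite /X exD// !exB// (coupling_hi m n (G m n)) (coupling_lo m n (G m n)).
  rewrite (coupling_hi m n (hcount k)) (coupling_lo m n (hcount k)).
  by rewrite !mean_passage// !mean_hcount//; ring.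
rewrite -coupling_lo.
apply: le_trans (_ : coupling m n (fun z => (gap <= `|X z - coupling m n X|)%R%:R) <= _).
  apply: (ex_le hC) => z; rewrite ler_nat; case: (boolP (hexit_event _ _ _ _)) => // hev.
  suff -> : gap <= `|X z - coupling m n X| by [].
  apply: le_trans (ler_norm _); rewrite EX; apply: le_trans hgap _.
  have := hexit_event_gap k0 (wt_lo_hi_bulk z) (wt_lo_hi_horizontal (z := z)) hev.
  rewrite -(ler_nat R) !natrD /X /passage /hcount => ?; lra.
apply: le_trans (chebyshev hC X gap0) _.
apply: ler_wpM2r; first by rewrite invr_ge0 sqr_ge0.
apply: le_trans (ex_var4 hC _ _ _ _) _; apply: ler_wpM2l => //.
rewrite (ex_var_map (G m n) (coupling_hi m n)) (ex_var_map (G m n) (coupling_lo m n)).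
rewrite (ex_var_map (hcount k) (coupling_hi m n)).
rewrite (ex_var_map (hcount k) (coupling_lo m n)).
have := ex_var_hcount n km hu; have := ex_var_hcount n km hw; lra.
Qed.

(** Outside the exit event [lpp_early_exit] applies, so a level reached by [hi_env] is also reached
    by [mid_env k]. *)
Lemma coupling_early_exit m n k (t : R) :
  stat p w m n (fun e => (t <= passage R m n (wt e))%R%:R) <=
  stat p w m n (fun e => (hexit_event (wt e) m n k)%:R) +
  coupling m n (fun z => (t <= passage R m n (wt (mid_env k z)))%R%:R).
Proof.
have hC := coupling_expectation m n.
rewrite -!coupling_hi -exD//; apply: (ex_le hC) => z; rewrite -natrD ler_nat.
case: (boolP (hexit_event _ _ _ _)) => [_|nex]; first by rewrite (leq_trans (leq_b1 _))// leq_addr.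
rewrite add0n; case: (lerP t) => //= h.
suff -> : t <= passage R m n (wt (mid_env k z)) by [].
apply: le_trans h _; rewrite ler_nat; apply: lpp_early_exit nex _ _ _ => [i j|l lk|l].
- by rewrite -wt_lo_hi_bulk.
- by rewrite wt_mid_horizontal.
- exact: wt_hi_lo_vertical.
Qed.

End Law.

Lemma hgain_le_event p u m n i : 0 < p < 1 -> 0 < u < 1 ->
  stat p u m n (hgain R m n i) <=
  stat p u m n (fun e => (hexit_event (wt e) m n i.+1)%:R) :> R.
Proof.
move=> hp hu; have hv := vparam_itv hp hu.
have hE : is_expectation (stat p u m n) by apply: env_law_expectation; lra.
apply: (ex_le hE) => e; rewrite /hgain /passage lerBlDl -natrD ler_nat.
exact: lpp_hupd_event.
Qed.

Lemma hgain_ge0 p u m n i : 0 < p < 1 -> 0 < u < 1 -> 0 <= stat p u m n (@hgain R m n i).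
Proof.
move=> hp hu; have hv := vparam_itv hp hu.
have hE : is_expectation (stat p u m n) by apply: env_law_expectation; lra.
apply: (ex_ge0 hE) => e; rewrite subr_ge0 ler_nat; apply: lpp_mono => y; exact: upd_mono.
Qed.

End Coupling.

(** * The characteristic direction *)

Section Characteristic.
Variable R : realType.

Definition denom (p u : R) : R := u + p * (1 - u).

Lemma denom_gt0 p u : 0 < p < 1 -> 0 < u < 1 -> 0 < denom p u.
Proof. exact: vparam_denom. Qed.

Lemma denom_lt1 p u : 0 < p < 1 -> 0 < u < 1 -> denom p u < 1.
Proof. by rewrite /denom => hp hu; nra. Qed.

Lemma denomB p u w : denom p w - denom p u = (1 - p) * (w - u).
Proof. rewrite /denom; ring. Qed.

(** Where the characteristic direction comes from: with [n * p] close to [N * D ^+ 2], the variances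
    of the two axes nearly agree, and so do [hcov] and [vcov]. *)
Lemma vparam_var p u : 0 < p < 1 -> 0 < u < 1 ->
  vparam p u * (1 - vparam p u) = p * (u * (1 - u)) / denom p u ^+ 2.
Proof.
move=> hp hu; have := denom_gt0 hp hu; rewrite /vparam /denom => d0.
by field; rewrite gt_eqF.
Qed.

Lemma bernoulli_var_le (q : R) : q * (1 - q) <= 4^-1.
Proof. by have := sqr_ge0 (q - 2^-1); rewrite expr2; lra. Qed.

Variables (p u : R) (N : nat).
Hypotheses (hp : 0 < p < 1) (hu : 0 < u < 1).
Local Notation n := (n_u p u N).
Local Notation D := (denom p u).

Lemma n_u_le : n%:R * p <= N%:R * D ^+ 2.
Proof.
have p0 : 0 < p by case/andP: hp.
rewrite -ler_pdivlMr// /n_u; have -> : p + (1 - p) * u = D by rewrite /denom; ring.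
have /truncn_itv/andP[] : 0 <= N%:R / p * D ^+ 2.
  by rewrite mulr_ge0 ?sqr_ge0// divr_ge0// ltW.
by move=> h _; apply: le_trans h _; rewrite mulrAC.
Qed.

Lemma n_u_gt : N%:R * D ^+ 2 - p <= n%:R * p.
Proof.
have p0 : 0 < p by case/andP: hp.
rewrite lerBlDr (_ : n%:R * p + p = (n%:R + 1) * p); last by ring.
rewrite -ler_pdivrMr// /n_u.
have -> : p + (1 - p) * u = D by rewrite /denom; ring.
have /truncn_itv/andP[] : 0 <= N%:R / p * D ^+ 2.
  by rewrite mulr_ge0 ?sqr_ge0// divr_ge0// ltW.
by move=> _ /ltW; rewrite -natr1 => h; apply: le_trans h; rewrite mulrAC.
Qed.

Definition V (w : R) : R :=
  ex_var (stat p w N n) (fun e => passage R N n (wt e)).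
Definition mean (w : R) : R := N%:R * w + n%:R * vparam p w.

Lemma stat_expectation w : 0 < w < 1 -> is_expectation (stat p w N n).
Proof.
move=> hw; have := vparam_itv hp hw; move: hp => hp' hv.
by apply: env_law_expectation; lra.
Qed.

Lemma V_ge0 w : 0 < w < 1 -> 0 <= V w.
Proof. by move=> hw; apply: ex_var_ge0; exact: stat_expectation. Qed.

Lemma hcov_ge0 w : 0 < w < 1 -> 0 <= hcov p w N n.
Proof.
move=> hw; rewrite hcov_gain//; apply: mulr_ge0; first by nra.
by apply: sumr_ge0 => i _; exact: hgain_ge0.
Qed.

(** Rounding [n] down makes [hcov] the larger covariance, so [V u] is at most [2 * hcov]. The factor
    one half is the bound for [2 * (u * (1 - u))]; it is what later allows the variance to be
    absorbed. *)
Lemma V_le_event : V u <= 2^-1 * \sum_(i < N)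
  stat p u N n (fun e => (hexit_event (wt e) N n i.+1)%:R).
Proof.
have [VE hv] := ex_var_cov hp hu N n.
have D0 := denom_gt0 hp hu.
have h : n%:R * (vparam p u * (1 - vparam p u)) <= N%:R * (u * (1 - u)).
  rewrite vparam_var//.
  rewrite (_ : n%:R * (p * (u * (1 - u)) / D ^+ 2) = n%:R * p * (u * (1 - u)) / D ^+ 2); last by ring.
  rewrite ler_pdivrMr ?exprn_gt0//.
  have := n_u_le; move: hu => hu'; have : 0 < u * (1 - u) by nra.
  by move=> u0 h; rewrite [leRHS]mulrAC ler_wpM2r// ltW.
have : V u <= 2 * hcov p u N n by rewrite /V VE; lra.
rewrite hcov_gain// => /le_trans; apply.
set S := \sum_(i < N) _; set S' := \sum_(i < N) _.
have SS' : S <= S' by apply: ler_sum => i _; exact: hgain_le_event.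
have S0 : 0 <= S by apply: sumr_ge0 => i _; exact: hgain_ge0.
have := bernoulli_var_le u; nra.
Qed.

(** The variance at [w] is written as [2 * vcov] plus [hcov - vcov]. The first part is controlled by
    [vgain_le]; the second is explicit and of order [N * (w - u)], because the direction is no
    longer characteristic for [w]. *)
Lemma V_compare w : u < w < 1 ->
  V w <= V u / (2 * (vparam p u * (1 - vparam p u))) + N%:R * (w - u) / (2 * D) + 1.
Proof.
move=> /andP[uw w1]; have hw : 0 < w < 1 by move: hu => hu'; lra.
have [VEw hvw] := ex_var_cov hp hw N n; have [VEu _] := ex_var_cov hp hu N n.
have D0 := denom_gt0 hp hu; have Dw0 := denom_gt0 hp hw.
have DB := denomB p u w.
have hvu := vparam_itv hp hu; have hvw' := vparam_itv hp hw.
have bu := bernoulli_var_le u; have bvw := bernoulli_var_le (vparam p w).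
have v0 : 0 < vparam p u * (1 - vparam p u) by nra.
have vw0 : 0 < vparam p w * (1 - vparam p w) by nra.
have hV : V w = 2 * vcov p w N n +
   (N%:R * (w * (1 - w)) - n%:R * (vparam p w * (1 - vparam p w))) by rewrite /V VEw; lra.
rewrite hV -addrA; apply: lerD.
  have : vcov p u N n <= V u by rewrite /V VEu lerDr hcov_ge0.
  rewrite !vcov_gain// => hB.
  set S := \sum_(j < _) _; set S' := \sum_(j < _) _ in hB.
  have SS : S <= S' by apply: ler_sum => j _; exact: vgain_le.
  have S0 : 0 <= S.
    apply: sumr_ge0 => j _; apply: (ex_ge0 (stat_expectation hw)) => e.
    by rewrite subr_ge0 ler_nat; apply: lpp_mono => y; exact: upd_mono.
  rewrite ler_pdivlMr; last by rewrite mulr_gt0.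
  apply: le_trans hB.
  set a := vparam p u * _ in v0 *; set b := vparam p w * _ in vw0 bvw *.
  have -> : 2 * (b * S) * (2 * a) = a * ((4 * b) * S) by ring.
  rewrite ler_pM2l//; apply: le_trans SS; rewrite -[leRHS]mul1r ler_wpM2r//; lra.
rewrite vparam_var//; rewrite vparam_var// in bvw.
set q := w * (1 - w); have q0 : 0 < q by rewrite /q; nra.
have q4 : q <= 4^-1 by exact: bernoulli_var_le.
have -> : N%:R * q - n%:R * (p * q / denom p w ^+ 2) =
   q / denom p w ^+ 2 * (N%:R * denom p w ^+ 2 - n%:R * p).
  by field; rewrite gt_eqF.
apply: le_trans (_ : q / denom p w ^+ 2 * (N%:R * (denom p w ^+ 2 - D ^+ 2) + p) <= _).
  apply: ler_wpM2l; first by rewrite divr_ge0 ?sqr_ge0// ltW.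
  by have := n_u_gt; lra.
rewrite mulrDr; apply: lerD; last by rewrite mulrAC [q * p]mulrC; move: bvw; rewrite -/q; lra.
rewrite mulrCA -mulrA; apply: ler_wpM2l => //.
rewrite mulrAC ler_pdivrMr ?exprn_gt0// [leRHS]mulrAC ler_pdivlMr; last by lra.
rewrite subr_sqr DB.
have uw' : 0 < w - u by lra.
have -> : q * ((1 - p) * (w - u) * (denom p w + D)) * (2 * D) =
  (w - u) * (q * (1 - p) * 2 * ((denom p w + D) * D)) by ring.
rewrite ler_pM2l//.
have DD : D < denom p w by move: hp => hp'; nra.
have h1 : (denom p w + D) * D <= 2 * denom p w ^+ 2 by rewrite expr2; nra.
have h2 : q * (1 - p) * 2 <= 2^-1 by move: hp => hp'; nra.
have h3 : 0 <= q * (1 - p) * 2 by move: hp => hp'; nra.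
apply: le_trans (_ : 2^-1 * (2 * denom p w ^+ 2) <= _); last by rewrite mulrA mulVf ?mul1r.
by apply: ler_pM => //; apply/ltW; rewrite mulr_gt0// addr_gt0.
Qed.

(** The choice of [n] makes the derivative of the mean vanish at [u] up to rounding, so only a
    second order term remains. The rounding error is at most the change of [vparam], hence below
    1. *)
Lemma mean_diff_le w w' : u <= w -> w < w' -> w' < 1 ->
  mean w' - mean w <= N%:R * (w' - w) * ((w - u) + (w' - u)) / D + 1.
Proof.
move=> uw ww' w'1.
have hw : 0 < w < 1 by move: hu => hu'; lra.
have hw' : 0 < w' < 1 by move: hu => hu'; lra.
have D0 := denom_gt0 hp hu; have Dw := denom_gt0 hp hw; have Dw' := denom_gt0 hp hw'.
have DB := denomB p u w; have DB' := denomB p u w'.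
have vB := vparamB hp hw hw'; rewrite -/(denom p w) -/(denom p w') in vB.
have vi := vparam_itv hp hw; have vi' := vparam_itv hp hw'.
have -> : mean w' - mean w = N%:R * (w' - w) + n%:R * (vparam p w' - vparam p w).
  by rewrite /mean; ring.
rewrite {1}vB.
have d0 : 0 < w' - w by lra.
have -> : N%:R * (w' - w) + n%:R * - (p * (w' - w) / (denom p w * denom p w')) =
  (w' - w) / (denom p w * denom p w') * (N%:R * (denom p w * denom p w') - n%:R * p).
  by field; rewrite !gt_eqF.
apply: le_trans (_ : (w' - w) / (denom p w * denom p w') *
   (N%:R * (denom p w * denom p w' - D ^+ 2) + p) <= _).
  apply: ler_wpM2l; first by rewrite divr_ge0// ?mulr_ge0// ltW.
  by have := n_u_gt; lra.
rewrite mulrDr; apply: lerD; last first.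
  have -> : (w' - w) / (denom p w * denom p w') * p = - (vparam p w' - vparam p w).
    by rewrite vB opprK; ring.
  by lra.
have -> : N%:R * (w' - w) * (w - u + (w' - u)) / D = (w' - w) * (N%:R * ((w - u + (w' - u)) / D)).
  by ring.
rewrite mulrAC -mulrA; rewrite ler_pM2l// -mulrA; apply: ler_wpM2l => //.
rewrite ler_pdivrMr ?mulr_gt0// [leRHS]mulrAC ler_pdivlMr//.
set a := w - u in DB *; set b := w' - u in DB' *.
have -> : denom p w = D + (1 - p) * a by rewrite -DB; ring.
have -> : denom p w' = D + (1 - p) * b by rewrite -DB'; ring.
have a0 : 0 <= a by rewrite /a; lra.
have b0 : 0 <= b by rewrite /b; lra.
set r := 1 - p; have r0 : 0 <= r by move: hp => hp'; rewrite /r; lra.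
have r1 : r <= 1 by move: hp => hp'; rewrite /r; lra.
rewrite -subr_ge0.
have -> : (a + b) * ((D + r * a) * (D + r * b)) - ((D + r * a) * (D + r * b) - D ^+ 2) * D =
  (1 - r) * ((a + b) * D ^+ 2) + r * (a ^+ 2 + b ^+ 2 + a * b * (2 - r)) * D
   + r ^+ 2 * (a * b) * (a + b) by ring.
have h1 : 0 <= 1 - r by lra.
have h2 : 0 <= 2 - r by lra.
have D0' := ltW D0.
by repeat first [exact: sqr_ge0 | assumption | apply: mulr_ge0 | apply: addr_ge0].
Qed.

(** Rounding [n] down now works in the favourable direction, so there is no error term. *)
Lemma mean_diff_ge w : u < w < 1 -> N%:R * (1 - p) * (w - u) ^+ 2 <= mean w - mean u.
Proof.
move=> /andP[uw w1]; have hw : 0 < w < 1 by move: hu => hu'; lra.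
have D0 := denom_gt0 hp hu; have Dw := denom_gt0 hp hw; have Dw1 := denom_lt1 hp hw.
have DB := denomB p u w.
have vB := vparamB hp hu hw; rewrite -/(denom p w) -/(denom p u) in vB.
have -> : mean w - mean u = N%:R * (w - u) + n%:R * (vparam p w - vparam p u).
  by rewrite /mean; ring.
rewrite {1}vB.
have d0 : 0 < w - u by lra.
have -> : N%:R * (w - u) + n%:R * - (p * (w - u) / (D * denom p w)) =
  (w - u) / (D * denom p w) * (N%:R * (D * denom p w) - n%:R * p).
  by field; rewrite !gt_eqF.
apply: le_trans (_ : (w - u) / (D * denom p w) * (N%:R * (D * denom p w) - N%:R * D ^+ 2) <= _);
  last first.
  apply: ler_wpM2l; first by rewrite divr_ge0// ?mulr_ge0// ltW.
  by have := n_u_le; lra.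
have -> : (w - u) / (D * denom p w) * (N%:R * (D * denom p w) - N%:R * D ^+ 2) =
  N%:R * (w - u) * (denom p w - D) / denom p w.
  by field; rewrite !gt_eqF.
rewrite DB ler_pdivlMr//.
have -> : N%:R * (1 - p) * (w - u) ^+ 2 * denom p w =
   (N%:R * (w - u) * ((1 - p) * (w - u))) * denom p w by ring.
rewrite -[leRHS]mulr1; apply: ler_wpM2l; last exact: ltW.
by move: hp => hp'; rewrite !mulr_ge0//; lra.
Qed.

End Characteristic.

(** * The upper bound *)

Section UpperBound.
Variable R : realType.

Lemma sum_inv_sqr_le (r M : nat) : (0 < r)%N ->
  \sum_(r <= i < M) (i.+1%:R ^+ 2)^-1 <= r%:R^-1 :> R.
Proof.
move=> r0; have [Mr|rM] := leqP M r; first by rewrite big_geq// invr_ge0.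
suff : \sum_(r <= i < M) (i.+1%:R ^+ 2)^-1 <= r%:R^-1 - M%:R^-1 :> R.
  by move=> /le_trans; apply; rewrite gerBl invr_ge0.
have hr : (0 : R) < r%:R by rewrite ltr0n.
rewrite -(subnKC (ltnW rM)); elim: (M - r)%N => [|k IH].
  by rewrite addn0 big_geq// subrr.
rewrite addnS big_nat_recr ?leq_addr//=.
apply: le_trans (lerD IH (lexx _)) _.
set x : R := (r + k)%:R; have x0 : 0 < x by rewrite /x natrD ltr_wpDr.
rewrite -natr1 -/x.
have -> : (r%:R : R)^-1 - (x + 1)^-1 = r%:R^-1 - x^-1 + (x^-1 - (x + 1)^-1) by ring.
rewrite lerD2l; have -> : x^-1 - (x + 1)^-1 = (x * (x + 1))^-1 by field; rewrite !gt_eqF//; lra.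
have x1 : 0 < x + 1 by lra.
rewrite lef_pV2 ?posrE ?mulr_gt0 ?exprn_gt0//.
by rewrite expr2; nra.
Qed.

Lemma sum_le_split (f : nat -> R) (r M : nat) : (forall i, 0 <= f i <= 1) ->
  \sum_(0 <= i < M) f i <= r%:R + \sum_(r <= i < M) f i.
Proof.
move=> hf; have h k : \sum_(0 <= i < k) f i <= k%:R.
  apply: le_trans (_ : \sum_(0 <= i < k) 1 <= _); last by rewrite sumr_const_nat subn0.
  by apply: ler_sum => i _; case/andP: (hf i).
have [Mr|rM] := leqP M r.
  by rewrite [X in _ + X]big_geq// addr0; apply: le_trans (h M) _; rewrite ler_nat.
by rewrite (big_cat_nat _ (ltnW rM))//= lerD2r.
Qed.

Variables p u : R.
Hypotheses (hp : 0 < p < 1) (hu : 0 < u < 1).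
Local Notation D := (denom p u).

Let c0 := (2 * (vparam p u * (1 - vparam p u)))^-1.
Let c1 := (2 * D)^-1.

Let c0_gt0 : 0 < c0.
Proof.
by have hv := vparam_itv hp hu; rewrite invr_gt0; nra.
Qed.

Let c1_gt0 : 0 < c1.
Proof. by rewrite invr_gt0 mulr_gt0// denom_gt0. Qed.

Lemma V_compare_le : exists c0 c1 : R, [/\ 0 < c0, 0 < c1 &
  forall N w, u < w < 1 -> V p u N w <= c0 * V p u N u + c1 * (N%:R * (w - u)) + 1].
Proof.
exists c0, c1; split => // N w uw; apply: le_trans (V_compare N hp hu uw) _.
by rewrite le_eqVlt; apply/orP; left; apply/eqP; rewrite /c0 /c1; ring.
Qed.

Lemma hexit_event_tail : exists C kappa : R, [/\ 0 < C, 0 < kappa &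
  forall N k, (0 < k <= N)%N -> 8 * N%:R <= kappa * k%:R ^+ 2 ->
  stat p u N (n_u p u N) (fun e => (hexit_event (wt e) N (n_u p u N) k)%:R)
    <= C * (N%:R ^+ 2 * (V p u N u + k%:R) / k%:R ^+ 4)].
Proof.
have [a0 [a1 [a00 a10 hV]]] := V_compare_le.
have D0 := denom_gt0 hp hu; have D1 := denom_lt1 hp hu.
have /andP[u0 u1] := hu.
(* With [w - u = kappa * k / N], the factor [1 - u] keeps [w] below 1 for [k <= N], and [D / 2]
   keeps the mean gain below half the gain of the path, up to rounding. *)
pose kappa := (1 - u) * D / 2.
have kappa0 : 0 < kappa by rewrite divr_gt0// mulr_gt0// subr_gt0.
(* The 64 is 4 from [hexit_event_prob] times 16 from the gap [y / 4]; the last factor bounds both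
   variances and [k / 2] by a multiple of [V u + k]. *)
exists (64 / kappa ^+ 2 * (a0 + a1 * kappa + 3)), kappa; split => //.
  by rewrite mulr_gt0// ?divr_gt0 ?exprn_gt0// !addr_gt0// mulr_gt0.
move=> N k /andP[k0 kN] hk.
have kR : 1 <= k%:R :> R by rewrite ler1n.
have NR : 1 <= N%:R :> R by rewrite ler1n (leq_trans k0).
have kNR : k%:R <= N%:R :> R by rewrite ler_nat.
pose w := u + kappa * k%:R / N%:R.
have wu : w - u = kappa * k%:R / N%:R by rewrite /w; ring.
have uw : u < w by rewrite -subr_gt0 wu divr_gt0// ?mulr_gt0//; lra.
have w1 : w < 1.
  rewrite -(ltrD2r (- u)) wu ltr_pdivrMr; last lra.
  apply: le_lt_trans (_ : kappa * N%:R < _); first by rewrite ler_pM2l.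
  by rewrite ltr_pM2r; [rewrite /kappa; nra|lra].
have hw : 0 < w < 1 by lra.
set y := kappa * k%:R ^+ 2 / N%:R.
(* From 8 on, [y - (y / 2 + 1) - 1] is at least [y / 4]: one unit pays for rounding, the other for
   the slack in [hexit_event]. *)
have y8 : 8 <= y by rewrite ler_pdivlMr; lra.
have kwu : k%:R * (w - u) = y by rewrite wu /y; ring.
have NR0 : (N%:R : R) != 0 by rewrite gt_eqF//; lra.
have hmean : mean p u N w - mean p u N u <= y / 2 + 1.
  apply: le_trans (mean_diff_le N hp hu (lexx u) uw w1) _.
  rewrite lerD2r subrr add0r wu.
  have -> : N%:R * (kappa * k%:R / N%:R) * (kappa * k%:R / N%:R) / D = y * (kappa / D).
    by rewrite /y; field; rewrite NR0 gt_eqF.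
  apply: ler_wpM2l; first lra.
  by rewrite ler_pdivrMr// /kappa; nra.
have y4 : 0 < y / 4 by lra.
have km : (0 < k <= N)%N by rewrite k0.
have := @hexit_event_prob R p u w hp hu hw uw N (n_u p u N) k (y / 4) km y4.
have -> : N%:R * (w - u) + (n_u p u N)%:R * (vparam p w - vparam p u) =
  mean p u N w - mean p u N u by rewrite /mean; ring.
rewrite kwu => h; apply: le_trans (h _) _; first by lra.
rewrite -/(V p u N w) -/(V p u N u).
have {}hV := hV N w; rewrite wu uw w1 in hV.
have {}hV : V p u N w <= a0 * V p u N u + a1 * (kappa * k%:R) + 1.
  by apply: le_trans (hV isT) _; rewrite [N%:R * _]mulrC divfK.
have V0 := V_ge0 u N hp hu.
set X := V p u N u in hV V0 *; set Y := V p u N w in hV *.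
have -> : (y / 4) ^+ 2 = kappa ^+ 2 * k%:R ^+ 4 / N%:R ^+ 2 / 16.
  by rewrite /y; field.
have -> : 64 / kappa ^+ 2 * (a0 + a1 * kappa + 3) * (N%:R ^+ 2 * (X + k%:R) / k%:R ^+ 4) =
  4 * ((a0 + a1 * kappa + 3) * (X + k%:R)) / (kappa ^+ 2 * k%:R ^+ 4 / N%:R ^+ 2 / 16).
  by field; rewrite NR0 !gt_eqF//; lra.
rewrite ler_pM2r; last first.
  have kR0 : 0 < k%:R :> R by exact: lt_le_trans kR.
  have NR1 : 0 < N%:R :> R by exact: lt_le_trans NR.
  by rewrite invr_gt0 divr_gt0// divr_gt0 ?exprn_gt0// mulr_gt0 ?exprn_gt0.
rewrite ler_pM2l//.
have t0 : 0 < a1 * kappa by rewrite mulr_gt0.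
have t1 : 0 <= a1 * kappa * X by rewrite mulr_ge0// ltW.
have t2 : 0 <= a0 * k%:R by rewrite mulr_ge0// ltW.
by lra.
Qed.

(** The real [s] stands for the cube root of [N], which keeps the estimates polynomial. *)
Lemma V_upper : exists2 C2 : R, 0 < C2 &
  forall N s, 1 <= s -> s ^+ 3 = N%:R -> V p u N u <= C2 * s ^+ 2.
Proof.
have [C [kappa [C0 kappa0 htail]]] := hexit_event_tail.
(* For [r] just above [K * s ^+ 2], the summand [C] gives [C * N ^ 2 <= r ^ 3], and [8 / kappa]
   makes the tail bound valid from [r] on. *)
pose K := 1 + C + 8 / kappa.
have k80 : 0 < 8 / kappa by rewrite divr_gt0.
have K1 : 1 <= K by rewrite /K; lra.
exists (2 * (K + 1)); first lra.
move=> N s s1 sN.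
have s2 : 1 <= s ^+ 2 by rewrite exprn_ege1.
pose r := (Num.truncn (K * s ^+ 2)).+1.
have Ks0 : 0 <= K * s ^+ 2 by rewrite mulr_ge0//; lra.
have /andP[r1 r2] : (Num.truncn (K * s ^+ 2))%:R <= K * s ^+ 2 < r%:R by exact: truncn_itv.
have rle : r%:R <= (K + 1) * s ^+ 2.
  by rewrite /r -natr1 [leRHS]mulrDl mul1r; apply: lerD.
have V0 := V_ge0 u N hp hu; set X := V p u N u in V0 *.
have r0 : 0 < r%:R :> R by rewrite ltr0n.
have rC : C * N%:R ^+ 2 <= r%:R ^+ 3.
  apply: le_trans (_ : (K * s ^+ 2) ^+ 3 <= _); last by rewrite lerXn2r ?nnegrE//; exact: ltW.
  rewrite -sN -exprM exprMn -exprM; apply: ler_wpM2r; first by rewrite exprn_ge0//; lra.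
  apply: le_trans (_ : K <= _); first by rewrite /K; lra.
  by rewrite ler_eXnr.
have rN k : (r <= k)%N -> 8 * N%:R <= kappa * k%:R ^+ 2.
  move=> rk; apply: le_trans (_ : kappa * r%:R ^+ 2 <= _); last first.
    by rewrite ler_pM2l// lerXn2r ?nnegrE// ler_nat.
  apply: le_trans (_ : kappa * (K * s ^+ 2) ^+ 2 <= _); last first.
    by rewrite ler_pM2l// lerXn2r ?nnegrE// ltW.
  rewrite -sN.
  have h1 : 8 <= kappa * K.
    by apply: le_trans (_ : kappa * (8 / kappa) <= _);
      [rewrite mulrC divfK// gt_eqF|rewrite ler_pM2l// /K; lra].
  have -> : kappa * (K * s ^+ 2) ^+ 2 = (kappa * K) * (K * s * s ^+ 3) by ring.
  apply: ler_pM => //; first by rewrite exprn_ge0//; lra.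
  rewrite -[leLHS]mul1r; apply: ler_wpM2r; first by rewrite exprn_ge0//; lra.
  by nra.
have hE := stat_expectation u N hp hu.
pose P i := stat p u N (n_u p u N) (fun e => (hexit_event (wt e) N (n_u p u N) i.+1)%:R).
have hP i : 0 <= P i <= 1.
  apply/andP; split; first by apply: (ex_ge0 hE) => e; exact: ler0n.
  by rewrite -(ex_one hE); apply: (ex_le hE) => e; case: (hexit_event _ _ _ _).
have hX : X <= 2^-1 * \sum_(0 <= i < N) P i.
  by rewrite big_mkord; exact: V_le_event.
have hsum : \sum_(r <= i < N) P i <= C * N%:R ^+ 2 * (X / r%:R ^+ 3 + r%:R ^- 2).
  apply: le_trans (_ : \sum_(r <= i < N) (C * N%:R ^+ 2 * (X / r%:R ^+ 2 + r%:R^-1)) *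
      (i.+1%:R ^+ 2)^-1 <= _).
    rewrite big_nat [leRHS]big_nat; apply: ler_sum => i /andP[ri iN].
    have i0 : 0 < i.+1%:R :> R by rewrite ltr0n.
    have ri' : r%:R <= i.+1%:R :> R by rewrite ler_nat leqW.
    apply: le_trans (htail N i.+1 iN (rN _ (leqW ri))) _; rewrite -/X.
    have -> : C * (N%:R ^+ 2 * (X + i.+1%:R) / i.+1%:R ^+ 4) =
      C * N%:R ^+ 2 * (X / i.+1%:R ^+ 2 + i.+1%:R^-1) * (i.+1%:R ^+ 2)^-1.
      by field; rewrite gt_eqF.
    apply: ler_wpM2r; first by rewrite invr_ge0 exprn_ge0.
    apply: ler_wpM2l; first by rewrite mulr_ge0 ?exprn_ge0// ltW.
    apply: lerD; last by rewrite lef_pV2 ?posrE.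
    apply: ler_wpM2l => //; rewrite lef_pV2 ?posrE ?exprn_gt0//.
    by rewrite lerXn2r ?nnegrE// ltW.
  rewrite -mulr_sumr; apply: le_trans (ler_wpM2l _ (sum_inv_sqr_le N (ltn0Sn _))) _.
    by rewrite !mulr_ge0 ?exprn_ge0 ?addr_ge0 ?mulr_ge0 ?invr_ge0 ?exprn_ge0// ltW.
  by rewrite -/r le_eqVlt; apply/orP; left; apply/eqP; field; rewrite gt_eqF.
have hsplit := sum_le_split r N hP.
have h3 : C * N%:R ^+ 2 * (X / r%:R ^+ 3 + r%:R ^- 2) <= X + r%:R.
  have -> : X + r%:R = r%:R ^+ 3 * (X / r%:R ^+ 3 + r%:R ^- 2) by field; rewrite gt_eqF.
  apply: ler_wpM2r => //; apply: addr_ge0; last by rewrite invr_ge0 exprn_ge0.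
  by rewrite divr_ge0// exprn_ge0.
(* The estimates combine to [X <= 2^-1 * (r + (X + r))], that is, [X <= 2 * r]. *)
by lra.
Qed.

End UpperBound.

(** * The lower bound *)

Section LowerBound.
Variable R : realType.
Variables p u : R.
Hypotheses (hp : 0 < p < 1) (hu : 0 < u < 1).
Local Notation D := (denom p u).

Lemma pow1D_le_expR (x : R) k : 0 <= x -> (1 + x) ^+ k <= expR (k%:R * x).
Proof.
by move=> x0; rewrite expRM_natl lerXn2r ?nnegrE ?expR_ge0 ?addr_ge0// expR_ge1Dx.
Qed.

(* Under the law of [mid_env k], which has parameter [w] on the first [k] horizontal sites
   only, the passage time exceeds its mean at [u] by [h] with probability at least one half;
   under the law at [u] this still happens with a probability bounded below. *)
Lemma V_ge_tilt N w k (h : R) : u < w < 1 -> (k <= N)%N -> 0 < h ->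
  mean p u N u + 2 * h <= mean p u N w -> V p u N w <= 4^-1 * h ^+ 2 ->
  stat p w N (n_u p u N) (fun e => (hexit_event (wt e) N (n_u p u N) k)%:R) <= 4^-1 ->
  expR (- (k%:R * ((w - u) ^+ 2 / (u * (1 - u))))) / 4 * h ^+ 2 <= V p u N u.
Proof.
move=> /andP[uw w1] kN h0 hmw hV ev.
have hw : 0 < w < 1 by move: hu => hu'; lra.
have uu0 : 0 < u * (1 - u) by move: hu => hu'; nra.
have hE := stat_expectation u N hp hu; have hEw := stat_expectation u N hp hw.
set n := n_u p u N in hE hEw ev *; set L := k%:R * _.
(* This level lies [h] above the mean at [u] and at least [h] below the mean at [w], so Chebyshev's
   inequality applies on both sides. *)
pose t := mean p u N u + h.
have q1 : 1 - 4^-1 <= stat p w N n (fun e => (t <= passage R N n (wt e))%R%:R).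
  have cheb := chebyshev hEw (fun e => passage R N n (wt e)) h0.
  rewrite (mean_passage hp hw) -/(mean p u N w) -/(V p u N w) in cheb.
  have hV4 : V p u N w / h ^+ 2 <= 4^-1 by rewrite ler_pdivrMr ?exprn_gt0.
  rewrite lerBlDr; apply: le_trans (_ : stat p w N n (fun=> 1) <= _).
    by rewrite (ex_one hEw).
  apply: le_trans (lerD (lexx _) (le_trans cheb hV4)).
  rewrite -exD//; apply: (ex_le hEw) => e.
  case: (lerP t) => [_|ht] /=; first by rewrite lerDl.
  suff -> : h <= `|passage R N n (wt e) - mean p u N w| by rewrite add0r.
  by rewrite distrC; apply: le_trans (ler_norm _); rewrite /t in ht; lra.
have q12 := coupling_early_exit hp hu hw uw N n k t.
have q3 := coupling_mid_change hp hu hw uw n (fun e => t <= passage R N n (wt e)) kN.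
set q := coupling _ _ _ _ _ _ in q12 q3.
set q4 := stat p u N n _ in q3.
have q2 : 2^-1 <= q by lra.
have q40 : 0 <= q4 by apply: (ex_ge0 hE) => e; exact: ler0n.
have q4L : 4^-1 <= expR L * q4.
  apply: le_trans (_ : q ^+ 2 <= _).
    have -> : 4^-1 = 2^-1 ^+ 2 :> R by field.
    by rewrite lerXn2r ?nnegrE ?invr_ge0//; apply: le_trans q2; rewrite invr_ge0.
  apply: le_trans q3 _; apply: ler_wpM2r => //; apply: pow1D_le_expR.
  by rewrite divr_ge0 ?sqr_ge0// ltW.
have q4eta : expR (- L) / 4 <= q4 by rewrite expRN mulrC ler_pdivrMr ?expR_gt0// mulrC.
have cheb := chebyshev hE (fun e => passage R N n (wt e)) h0.
rewrite (mean_passage hp hu) -/(mean p u N u) -/(V p u N u) in cheb.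
rewrite ler_pdivlMr ?exprn_gt0// in cheb; apply: le_trans cheb.
apply: ler_wpM2r; first exact: sqr_ge0.
apply: le_trans q4eta _; apply: (ex_le hE) => e; rewrite ler_nat.
case: lerP => //= ht; suff -> : h <= `|passage R N n (wt e) - mean p u N u| by [].
by apply: le_trans (ler_norm _); rewrite /t in ht; lra.
Qed.

(** The exit bound is needed at [u + delta], off its own characteristic direction, and comes from
    comparison with [u + 2 * delta]. With [y = N * delta ^+ 2], the path gains at least [4 * y / D]
    and the mean at most [3 * y / D + 1]; [4 <= y] then leaves a gap of [y / 2]. *)
Lemma hexit_event_tilt N k (delta : R) : 0 < delta -> 2 * delta < 1 - u ->
  (0 < k <= N)%N -> 4 * (N%:R * delta) <= k%:R * D -> 4 <= N%:R * delta ^+ 2 ->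
  stat p (u + delta) N (n_u p u N) (fun e => (hexit_event (wt e) N (n_u p u N) k)%:R) <=
  16 * (V p u N (u + 2 * delta) + V p u N (u + delta) + k%:R / 2)
    / (N%:R * delta ^+ 2) ^+ 2.
Proof.
move=> d0 d1 km kD Nd.
have D0 := denom_gt0 hp hu; have D1 := denom_lt1 hp hu.
set w := u + delta; set w' := u + 2 * delta.
have uw : u < w by rewrite /w; lra.
have ww' : w < w' by rewrite /w /w'; lra.
have w'1 : w' < 1 by rewrite /w'; lra.
have hw : 0 < w < 1 by move: hu => hu'; lra.
have hw' : 0 < w' < 1 by move: hu => hu'; lra.
set y := N%:R * delta ^+ 2 in Nd *.
have gap0 : 0 < y / 2 by lra.
have := @hexit_event_prob R p w w' hp hw hw' ww' N (n_u p u N) k _ km gap0.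
have -> : N%:R * (w' - w) + (n_u p u N)%:R * (vparam p w' - vparam p w) =
  mean p u N w' - mean p u N w by rewrite /mean; ring.
have dww : w' - w = delta by rewrite /w /w'; ring.
have hm := mean_diff_le N hp hu (ltW uw) ww' w'1.
have e3 : N%:R * (w' - w) * (w - u + (w' - u)) / D = 3 * (y / D).
  by rewrite /y /w /w'; ring.
rewrite e3 in hm; rewrite dww.
have kd : 4 * (y / D) <= k%:R * delta.
  rewrite mulrA ler_pdivrMr//.
  have -> : 4 * y = 4 * (N%:R * delta) * delta by rewrite /y; ring.
  by rewrite [leRHS]mulrAC ler_pM2r.
have yD : y <= y / D by rewrite ler_pdivlMr// -[leRHS]mulr1 ler_pM2l ?ltW//; lra.
move=> h; apply: le_trans (h _) _; first by lra.
by rewrite le_eqVlt; apply/orP; left; apply/eqP; rewrite /V -/w'; field; rewrite gt_eqF//; lra.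
Qed.

Lemma V_lower : exists C1 s0 : R, 0 < C1 /\
  forall N s, s0 <= s -> s ^+ 3 = N%:R -> C1 * s ^+ 2 <= V p u N u.
Proof.
have [C2 C20 hup] := V_upper hp hu.
have [c0 [c1 [c00 c10 hV]]] := V_compare_le hp hu.
have D0 := denom_gt0 hp hu; have D1 := denom_lt1 hp hu.
have /andP[u0 u1] := hu; have /andP[p0 p1] := hp.
(* [E * (rho * s ^+ 2)] will bound both variances plus [k / 2]; [E] itself does not depend on
   [rho]. *)
pose E := 2 * (c0 * C2) + 3 * c1 + 2 / D + 3.
have cC : 0 < c0 * C2 by rewrite mulr_gt0.
have D20 : 0 < 2 / D by rewrite divr_gt0.
have E0 : 0 < E by rewrite /E; lra.
have p10 : 0 < (1 - p) ^+ 2 by rewrite exprn_gt0// subr_gt0.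
have p11 : (1 - p) ^+ 2 <= 1 by rewrite exprn_ile1//; lra.
(* The exit bound needs [64 * E <= rho ^+ 3], Chebyshev's inequality at [w] needs
   [16 * E <= (1 - p) ^+ 2 * rho ^+ 3]. *)
pose rho := 64 * E / (1 - p) ^+ 2 + 1.
have hrho : 64 * E <= (1 - p) ^+ 2 * rho.
  have -> : (1 - p) ^+ 2 * rho = 64 * E + (1 - p) ^+ 2.
    by rewrite /rho; field; rewrite gt_eqF// subr_gt0.
  lra.
have rho1 : 1 <= rho.
  by rewrite /rho lerDr; apply/ltW/divr_gt0 => //; rewrite mulr_gt0.
have rho0 : 0 < rho by lra.
have hrho' : 64 * E <= rho.
  by apply: le_trans hrho _; rewrite -[leRHS]mul1r ler_pM2r.
have rho3 : rho <= rho ^+ 3 by rewrite ler_eXnr.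
(* Bound, uniform in [N], for the exponent [k * delta ^+ 2 / (u * (1 - u))] of the chi-square
   factor. *)
pose L := (4 * rho ^+ 3 / D + 1) / (u * (1 - u)).
pose eta := expR (- L) / 4.
have eta0 : 0 < eta by rewrite divr_gt0 ?expR_gt0.
have uu0 : 0 < u * (1 - u) by rewrite mulr_gt0 ?subr_gt0.
(* The threshold for [s] ensures [k <= N], [delta <= 1] and [u + 2 * delta < 1]. *)
exists (eta * ((1 - p) * rho ^+ 2 / 2) ^+ 2), (4 * (rho / D) + 4 * (rho / (1 - u)) + 5).
split; first by rewrite mulr_gt0// exprn_gt0// divr_gt0// mulr_gt0 ?exprn_gt0 ?subr_gt0.
move=> N s s0 sN.
have b1 : 0 < rho / D by rewrite divr_gt0.
have b2 : 0 < rho / (1 - u) by rewrite divr_gt0 ?subr_gt0.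
have b1' : rho <= rho / D by rewrite ler_pdivlMr// -[leRHS]mulr1 ler_pM2l// ltW.
have [s5 sD srho su'] : [/\ 5 <= s, 4 * (rho / D) + 1 <= s, rho <= s
    & 2 * (rho / (1 - u)) < s].
  by move: s0 b1 b2 b1' rho0; clear; split; lra.
have ss0 : 0 < s by exact: lt_le_trans s5.
have s1 : 1 <= s by apply: le_trans s5; rewrite ler1n.
have s21 : 1 <= s ^+ 2 by rewrite exprn_ege1.
have s20 : 0 < s ^+ 2 by exact: lt_le_trans s21.
have su : 2 * rho < (1 - u) * s.
  by rewrite -ltr_pdivrMl ?subr_gt0// mulrCA [_^-1 * _]mulrC.
pose delta := rho / s.
have d0 : 0 < delta by rewrite divr_gt0.
have d1 : delta <= 1 by rewrite ler_pdivrMr// mul1r.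
have d2 : 2 * delta < 1 - u by rewrite /delta mulrA ltr_pdivrMr.
have Nd : N%:R * delta = rho * s ^+ 2 by rewrite -sN /delta; field; rewrite gt_eqF.
have Nd2 : N%:R * delta ^+ 2 = rho ^+ 2 * s by rewrite -sN /delta; field; rewrite gt_eqF.
(* This length meets the requirement [4 * (N * delta) <= k * D] of [hexit_event_tilt], as
   [N * delta = rho * s ^+ 2]. *)
pose k := (Num.truncn (4 * (rho / D) * s ^+ 2)).+1.
have ks0 : 0 <= 4 * (rho / D) * s ^+ 2 by apply/ltW; rewrite mulr_gt0// mulr_gt0.
have /andP[k1 /ltW k2] :
  (Num.truncn (4 * (rho / D) * s ^+ 2))%:R <= 4 * (rho / D) * s ^+ 2 < k%:R by exact: truncn_itv.
have kle : k%:R <= 4 * (rho / D) * s ^+ 2 + 1 by rewrite /k -natr1 lerD2r.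
have kN : (0 < k <= N)%N.
  rewrite /= -(ler_nat R); apply: le_trans kle _; rewrite -sN.
  apply: le_trans (_ : (4 * (rho / D) + 1) * s ^+ 2 <= _); first by rewrite [leRHS]mulrDl mul1r lerD2l.
  by rewrite [s ^+ 3]exprS; apply: ler_wpM2r => //; exact: ltW.
have rs : 4 <= rho ^+ 2 * s.
  apply: le_trans (_ : 1 * s <= _); last by rewrite ler_pM2r// exprn_ege1.
  by rewrite mul1r; apply: le_trans s5; rewrite ler_nat.
pose a := rho * s ^+ 2.
have a1 : 1 <= a by rewrite /a mulr_ege1.
have a0 : 0 < a by exact: lt_le_trans a1.
have VX : c0 * V p u N u <= c0 * C2 * a.
  rewrite -mulrA ler_pM2l//; apply: le_trans (hup _ _ s1 sN) _; rewrite ler_pM2l//.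
  by rewrite /a -[leLHS]mul1r ler_pM2r.
have VW : V p u N (u + delta) <= c0 * C2 * a + c1 * a + 1.
  have := hV N (u + delta).
  rewrite (_ : u + delta - u = delta); [rewrite Nd -/a => h|by ring].
  apply: le_trans (h _) _; last by rewrite !lerD2r.
  by move: d0 d2; clear; lra.
have VW' : V p u N (u + 2 * delta) <= c0 * C2 * a + c1 * (2 * a) + 1.
  have := hV N (u + 2 * delta).
  rewrite (_ : u + 2 * delta - u = 2 * delta); [|by ring].
  rewrite [N%:R * (2 * _)]mulrCA Nd -/a => h.
  apply: le_trans (h _) _; last by rewrite !lerD2r.
  by move: d0 d2; clear; lra.
have Da : 4 * (rho / D) * s ^+ 2 = 2 * (2 / D * a) by rewrite /a; ring.
have VE : V p u N (u + 2 * delta) + V p u N (u + delta) + k%:R / 2 <= E * a.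
  rewrite Da in kle.
  have -> : E * a = 2 * (c0 * C2 * a) + 3 * (c1 * a) + 2 / D * a + 3 * a.
    by rewrite /E; ring.
  by move: kle VW VW' a1; clear; lra.
have VWE : V p u N (u + delta) <= E * a.
  apply: le_trans VE; rewrite addrAC lerDr addr_ge0//.
  by apply: V_ge0 => //; move: u0 d0 d2; clear; lra.
pose h := (1 - p) * rho ^+ 2 * s / 2.
have h0 : 0 < h by rewrite /h divr_gt0// mulr_gt0// mulr_gt0 ?exprn_gt0 ?subr_gt0.
have := @V_ge_tilt N (u + delta) k h.
have -> : u + delta - u = delta by ring.
have -> : eta * ((1 - p) * rho ^+ 2 / 2) ^+ 2 * s ^+ 2 = eta * h ^+ 2 by rewrite /h; field.
have uw1 : u < u + delta < 1 by move: d0 d2; clear; lra.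
move=> hlow; apply: le_trans (_ : _ * h ^+ 2 <= _) (hlow uw1 _ h0 _ _ _).
- apply: ler_wpM2r; first exact: sqr_ge0.
  rewrite /eta ler_pM2r ?invr_gt0// ler_expR lerN2 /L mulrA ler_pM2r ?invr_gt0//.
  apply: le_trans (_ : (4 * (rho / D) * s ^+ 2 + 1) * delta ^+ 2 <= _).
    by apply: ler_wpM2r => //; exact: sqr_ge0.
  rewrite mulrDl mul1r; apply: lerD; last by rewrite exprn_ile1// ltW.
  by rewrite le_eqVlt; apply/orP; left; apply/eqP; rewrite /delta; field; rewrite !gt_eqF.
- by case/andP: kN.
- have := mean_diff_ge N hp hu uw1.
  have -> : N%:R * (1 - p) * (u + delta - u) ^+ 2 = 2 * h.
    by rewrite (_ : u + delta - u = delta); [rewrite mulrAC Nd2 /h; field|ring].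
  by clear; lra.
- apply: le_trans VWE _.
  have -> : 4^-1 * h ^+ 2 = 16^-1 * ((1 - p) ^+ 2 * rho * rho ^+ 2) * a.
    by rewrite /h /a; field.
  rewrite ler_pM2r//.
  have : (1 - p) ^+ 2 * rho <= (1 - p) ^+ 2 * rho * rho ^+ 2.
    rewrite -[leLHS]mulr1; apply: ler_wpM2l; last by rewrite exprn_ege1.
    by rewrite mulr_ge0// ltW.
  by move: hrho E0; clear; lra.
- apply: le_trans (hexit_event_tilt d0 d2 kN _ _) _.
  + rewrite Nd; apply: le_trans (_ : 4 * (rho / D) * s ^+ 2 * D <= _).
      by rewrite le_eqVlt; apply/orP; left; apply/eqP; field; rewrite gt_eqF.
    by rewrite ler_pM2r.
  + by rewrite Nd2.
  + rewrite Nd2 ler_pdivrMr; last by rewrite exprn_gt0// mulr_gt0// exprn_gt0.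
    have -> : 4^-1 * (rho ^+ 2 * s) ^+ 2 = 16 * (64^-1 * rho ^+ 3 * a) by rewrite /a; field.
    rewrite ler_pM2l//; apply: le_trans VE _; rewrite ler_pM2r//.
    by move: hrho' rho3; clear; lra.
Qed.

End LowerBound.

(** * From the probability space to the expectation functional *)

Definition env_of (m n : nat) (w : site -> bool) : env :=
  ([seq w (i, 0)%N | i <- iota 1 m],
   [seq (w (0, j)%N, [seq w (i, j) | i <- iota 1 m]) | j <- iota 1 n]).

(** Sites in the order in which [env] stores its bits, without the origin, so that [take], [drop]
    and [rows_of] recover [env_of] from the list of their values. *)
Definition box_sites (m n : nat) : seq site :=
  [seq (i, 0)%N | i <- iota 1 m] ++
  flatten [seq (0, j)%N :: [seq (i, j) | i <- iota 1 m] | j <- iota 1 n].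

Lemma box_sites_uniq m n : uniq (box_sites m n).
Proof.
(* The enumeration of the full rectangle row by row starts with the origin; its tail is [box_sites]
   by computation. *)
have : uniq [seq (i, j) | j <- iota 0 n.+1, i <- iota 0 m.+1].
  by apply: allpairs_uniq => [||[a b] [c e] _ _ /= [-> ->]]//; exact: iota_uniq.
by case/andP.
Qed.

Lemma eq_lpp (w w' : site -> bool) m n :
  (forall i j, (i <= m)%N -> (j <= n)%N -> (0 < i + j)%N -> w (i, j) = w' (i, j)) ->
  lpp w m n = lpp w' m n.
Proof.
elim: m n => [|m IHm] n ww'.
  by apply: eq_big_nat => t /andP[_ tn]; rewrite ww'.
elim: n ww' => [|n IHn] ww'.
  by rewrite !lppi0; apply: eq_big_nat => t /andP[_ tn]; rewrite ww'.
rewrite !lppSS IHn => [|i j im jn ij]; last by rewrite ww'// ltnW.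
rewrite (IHm n.+1) => [|i j im jn ij]; last by rewrite ww'// ltnW.
rewrite (IHm n) => [|i j im jn ij]; last by rewrite ww'// ltnW.
by rewrite ww'.
Qed.

Lemma lpp_env_of w m n : lpp (wt (env_of m n w)) m n = lpp w m n.
Proof.
apply: eq_lpp => -[|i] [|j] im jn //= _.
- by rewrite (nth_map 0%N) ?size_iota// nth_iota.
- by rewrite (nth_map 0%N) ?size_iota// nth_iota.
- rewrite (nth_map 0%N) ?size_iota//= (nth_map 0%N) ?size_iota//.
  by rewrite !nth_iota.
Qed.

Lemma map_cst (A B : Type) (y : B) (s : seq A) : [seq y | _ <- s] = nseq (size s) y.
Proof. by elim: s => //= _ s ->. Qed.

Section SeqLaw.
Variable R : realType.

Fixpoint seq_law (qs : seq R) (f : seq bool -> R) : R :=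
  if qs is q :: qs' then coin q (fun x => seq_law qs' (fun l => f (x :: l))) else f [::].

Lemma seq_law_cat qs qs' f :
  seq_law (qs ++ qs') f = seq_law qs (fun l => seq_law qs' (fun l' => f (l ++ l'))).
Proof. by elim: qs f => [//|q qs IH] f /=; apply: eq_ex => x; rewrite IH. Qed.

Lemma seq_law_nseq q n f : seq_law (nseq n q) f = iid (coin q) n f.
Proof. by elim: n f => [//|n IH] f /=; apply: eq_ex => x; rewrite IH. Qed.

Fixpoint rows_of (m n : nat) (l : seq bool) : seq (bool * seq bool) :=
  if n is n'.+1 then
    (head false l, take m (behead l)) :: rows_of m n' (drop m (behead l))
  else [::].

Lemma seq_law_rows (p q : R) m n g : 0 <= p <= 1 ->
  seq_law (flatten (nseq n (q :: nseq m p))) (fun l => g (rows_of m n l)) =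
  iid (indep (coin q) (iid (coin p) m)) n g.
Proof.
move=> hp; elim: n g => [//|n IH] g /=; rewrite /indep; apply: eq_ex => b.
rewrite seq_law_cat seq_law_nseq.
apply: (supported_eq (iid_size (coin_expectation hp) (n := m))) => o om.
rewrite -(IH (fun s => g ((b, o) :: s))); apply: eq_ex => l.
by rewrite /= take_size_cat// drop_size_cat.
Qed.

Lemma seq_law_env (p qa qb : R) m n F : 0 <= p <= 1 -> 0 <= qa <= 1 ->
  seq_law (nseq m qa ++ flatten (nseq n (qb :: nseq m p)))
    (fun l => F (take m l, rows_of m n (drop m l))) = env_law p qa qb m n F.
Proof.
move=> hp ha; rewrite seq_law_cat seq_law_nseq /env_law /indep.
apply: (supported_eq (iid_size (coin_expectation ha) (n := m))) => a am.
rewrite -(seq_law_rows qb m n (fun rows => F (a, rows)) hp); apply: eq_ex => l.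
by rewrite take_size_cat// drop_size_cat.
Qed.

Lemma rows_of_box w m n j :
  rows_of m n [seq w x | x <- flatten [seq (0, j)%N :: [seq (i, j) | i <- iota 1 m]
                                      | j <- iota j n]] =
  [seq (w (0, j)%N, [seq w (i, j) | i <- iota 1 m]) | j <- iota j n].
Proof.
elim: n j => [//|n IH] j /=; rewrite map_cat -map_comp.
by rewrite take_size_cat ?drop_size_cat ?size_map ?size_iota// IH.
Qed.

End SeqLaw.

Local Open Scope classical_set_scope.

(** * Integration of functions of independent bits *)

Section Transfer.
Context d (T : measurableType d) (R : realType) (P : probability T R).
Variables (I : eqType) (X : I -> {RV P >-> bool}) (q : I -> R).
Hypothesis indepX : mutually_independent X.

Definition cylinder (s : seq I) (c : I -> bool) : set T :=
  \bigcap_(i in [set` s]) (X i @^-1` [set c i]).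

Lemma measurable_cylinder s c : measurable (cylinder s c).
Proof.
apply: fin_bigcap_measurable; first exact: finite_seq.
by move=> i _; rewrite -[_ @^-1` _]setTI; exact: measurable_funP.
Qed.

Lemma measurable_fun_seq (s : seq I) (f : seq bool -> R) :
  measurable_fun setT (fun t => f [seq X i t | i <- s]).
Proof.
elim: s f => [|i s IH] f /=; first exact: measurable_cst.
rewrite (_ : (fun t => _) = (fun t => if X i t then f (true :: [seq X i t | i <- s])
   else f (false :: [seq X i t | i <- s]))); last by apply/funext => t; case: (X i t).
apply: measurable_fun_ifT; first exact: measurable_funP.
  exact: (IH (fun l => f (true :: l))).
exact: (IH (fun l => f (false :: l))).
Qed.

Lemma prob_cylinder_cons i s c : i \notin s -> uniq s ->
  P (cylinder (i :: s) c) = (P (X i @^-1` [set c i]) * P (cylinder s c))%E.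
Proof.
move=> si us; rewrite /cylinder !(indepX (A := fun i => [set c i]))//= ?si//.
by rewrite big_cons.
Qed.

Lemma cylinder_split i s c (b : bool) : i \notin s ->
  cylinder (i :: s) (fun k => if k == i then b else c k) =
  cylinder s c `&` (X i @^-1` [set b]).
Proof.
move=> si; apply/seteqP; split => t /= h.
  split; last by have := h i; rewrite /= mem_head eqxx; exact.
  move=> k /= ks; have := h k; rewrite /= inE ks orbT; case: eqP => [ki|_]; last exact.
  by rewrite -ki ks in si.
move=> k /=; rewrite inE => /orP[/eqP ->|ks]; first by rewrite eqxx; case: h.
case: eqP => [ki|_]; first by rewrite -ki ks in si.
by case: h => h _; exact: h.
Qed.

(** The cylinder makes the induction work: splitting by the value of the first bit moves that
    coordinate from the integrand into the cylinder, whose probability factorises. *)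
Lemma integral_cylinder (s s' : seq I) c (f : seq bool -> R) :
  (forall i b, i \in s -> P (X i @^-1` [set b]) = (if b then q i else 1 - q i)%:E) ->
  uniq (s ++ s') ->
  (\int[P]_(t in cylinder s' c) (f [seq X i t | i <- s])%:E =
   P (cylinder s' c) * (seq_law (map q s) f)%:E)%E.
Proof.
elim: s s' c f => [|i s IH] s' c f hq us /=.
  by rewrite [RHS]muleC -(integral_cst P (measurable_cylinder s' c)).
have [is' us'] : i \notin s' /\ uniq s'.
  move: us; rewrite /= mem_cat negb_or cat_uniq.
  by case/andP => /andP[_ ->] /and3P[].
pose D b := cylinder s' c `&` (X i @^-1` [set b]).
have mD b : measurable (D b).
  by rewrite /D -cylinder_split//; exact: measurable_cylinder.
have DE : cylinder s' c = D true `|` D false.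
  apply/seteqP; split => [t h|t [[]|[]]//]; rewrite /D.
  by case E : (X i t); [left|right]; split => //=; rewrite E.
rewrite [in LHS]DE integral_setU//=; last 2 first.
- apply/measurable_EFinP.
  by apply: measurable_funS (measurable_fun_seq (i :: s) f).
- apply/disj_setPS => t [[_ /= h1] [_ /= h2]].
  by move: h1; rewrite /= h2.
have step b : (\int[P]_(t in D b) (f (X i t :: [seq X i t | i <- s]))%:E =
    P (cylinder s' c) * ((if b then q i else 1 - q i) *
       seq_law (map q s) (fun l => f (b :: l)))%:E)%E.
  rewrite (eq_integral (fun t => (f (b :: [seq X i t | i <- s]))%:E)); last first.
    by move=> t; rewrite inE => -[_ /= ->].
  rewrite /D -cylinder_split// (IH _ _ (fun l => f (b :: l))); first last.
  - by rewrite -(cat1s i s') uniq_catCA.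
  - by move=> k b' ks; apply: hq; rewrite inE ks orbT.
  rewrite prob_cylinder_cons//= eqxx hq ?mem_head// EFinM muleA; congr (_ * _)%E.
  rewrite muleC; congr (_ * _)%E; congr (P _).
  apply/seteqP; split => t h k /= ks; have := h k ks => /=.
    by case: eqP => // ki; rewrite -ki ks in is'.
  by case: eqP => // ki; rewrite -ki ks in is'.
rewrite !step -muleDr//; last by rewrite fin_num_measure//; exact: measurable_cylinder.
Qed.

Lemma integral_seq_law (s : seq I) (f : seq bool -> R) :
  (forall i b, i \in s -> P (X i @^-1` [set b]) = (if b then q i else 1 - q i)%:E) ->
  uniq s ->
  (\int[P]_t (f [seq X i t | i <- s])%:E = (seq_law (map q s) f)%:E)%E.
Proof.
move=> hq us; have := @integral_cylinder s [::] (fun=> true) f hq.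
rewrite cats0 => /(_ us).
have -> : cylinder [::] (fun=> true) = setT by apply/seteqP; split.
by rewrite probability_setT mul1e.
Qed.

End Transfer.

Lemma bernoulli_point d (T : measurableType d) (R : realType) (P : probability T R)
    (X : {RV P >-> bool}) (q : R) (b : bool) : 0 <= q <= 1 -> is_bernoulli X q ->
  P (X @^-1` [set b]) = (if b then q else 1 - q)%:E.
Proof.
move=> hq hX; have := hX [set b]; rewrite /distribution /pushforward => ->.
rewrite bernoulli_probE// !diracE; case: b.
  by rewrite mem_set// memNset// mule1 mule0 adde0.
by rewrite memNset// mem_set// mule1 mule0 add0e.
Qed.

Section Environment.
Context d (T : measurableType d) (R : realType) (P : probability T R).
Variables (p u : R) (omega : site -> {RV P >-> bool}).
Hypotheses (hp : 0 < p < 1) (hu : 0 < u < 1).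
Hypothesis henv : boundary_environment p u omega.

Definition site_param (x : site) : R :=
  if x.2 == 0%N then u else if x.1 == 0%N then vparam p u else p.

Lemma integral_env (m n : nat) (F : env -> R) :
  (\int[P]_t (F (env_of m n (fun x => omega x t)))%:E = (stat p u m n F)%:E)%E.
Proof.
have [indep hbulk hhor hver _] := henv.
have p01 : 0 <= p <= 1 by move: hp => hp'; lra.
have u01 : 0 <= u <= 1 by move: hu => hu'; lra.
have v01 : 0 <= vparam p u <= 1 by have := vparam_itv hp hu; lra.
pose f l := F (take m l, rows_of m n (drop m l)).
have -> : (fun t => (F (env_of m n (fun x => omega x t)))%:E) =
    (fun t => (f [seq omega x t | x <- box_sites m n])%:E).
  apply/funext => t; rewrite /f /box_sites map_cat -map_comp.
  rewrite take_size_cat ?drop_size_cat ?size_map ?size_iota//.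
  by rewrite (rows_of_box (fun x => omega x t)).
rewrite (@integral_seq_law _ _ _ _ _ omega site_param)//.
- congr (_%:E); rewrite /stat -(seq_law_env (vparam p u) m n F p01 u01); congr (seq_law _ _).
  rewrite /box_sites map_cat -map_comp map_flatten -map_comp; congr (_ ++ flatten _).
    by rewrite (eq_map (g := fun=> u))// map_cst size_iota.
  rewrite -[n in RHS](size_iota 1) -map_cst; apply/eq_in_map => j.
  rewrite mem_iota => /andP[j1 _] /=; rewrite /site_param /= gtn_eqF//; congr (_ :: _).
  rewrite -map_comp -[m in RHS](size_iota 1) -map_cst; apply/eq_in_map => i.
  by rewrite mem_iota => /andP[i1 _] /=; rewrite !gtn_eqF.
- move=> x b; rewrite /box_sites mem_cat => /orP[/mapP[i]|/flatten_mapP[j]].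
    by rewrite mem_iota => /andP[i1 _] ->; case: i i1 => // i _; exact: bernoulli_point.
  rewrite mem_iota => /andP[j1 _]; case: j j1 => // j _; rewrite inE => /orP[/eqP ->|/mapP[i]].
    exact: bernoulli_point.
  by rewrite mem_iota => /andP[i1 _] ->; case: i i1 => // i _; exact: bernoulli_point.
- exact: box_sites_uniq.
Qed.

Lemma boundary_passage_variance m n :
  'V_P[boundary_passage omega m n] =
  (ex_var (stat p u m n) (fun e => passage R m n (wt e)))%:E.
Proof.
have E1 : boundary_passage omega m n =
    (fun t => passage R m n (wt (env_of m n (fun x => omega x t)))).
  by apply/funext => t; rewrite /boundary_passage last_passage_lpp /passage lpp_env_of.
rewrite /variance unlock /= !unlock E1.
rewrite (integral_env m n (fun e => passage R m n (wt e))) /=.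
set c := stat _ _ _ _ _.
rewrite -(integral_env m n (fun e => (passage R m n (wt e) - c) ^+ 2)).
by apply: eq_integral => t _; rewrite expr2.
Qed.

End Environment.

Local Close Scope classical_set_scope.

Theorem theorem2p3 (R : realType) (p u : R)
    (hp : 0 < p < 1) (hu : 0 < u < 1) :
  exists C1 C2 : R, [/\ 0 < C1, 0 < C2 &
    exists N0 : nat,
      forall (d : measure_display) (T : measurableType d) (P : probability T R)
        (omega : site -> {RV P >-> bool}),
        boundary_environment p u omega ->
        forall N : nat, (N0 <= N)%N ->
          ((C1 * N%:R `^ (2 / 3))%:E
             <= 'V_P[boundary_passage omega N (n_u p u N)])%E /\
          ('V_P[boundary_passage omega N (n_u p u N)]
             <= (C2 * N%:R `^ (2 / 3))%:E)%E].
Proof.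
have [C2 C20 hup] := V_upper hp hu.
have [C1 [s0 [C10 hlow]]] := V_lower hp hu.
exists C1, C2; split => //.
pose S := Num.max s0 1.
(* This exceeds [S ^+ 3], so the cube root of [N] is at least [S], as both bounds require. *)
exists (Num.truncn (S ^+ 3)).+1 => d T P omega henv N hN.
rewrite (boundary_passage_variance hp hu henv) !lee_fin.
pose s : R := N%:R `^ 3^-1.
have s3 : s ^+ 3 = N%:R.
  by rewrite /s -powR_mulrn ?powR_ge0// -powRrM mulVf// powRr1.
have s2 : N%:R `^ (2 / 3) = s ^+ 2.
  by rewrite /s -powR_mulrn ?powR_ge0// -powRrM mulrC.
have Ss : S <= s.
  rewrite leNgt; apply/negP => sS.
  have s0' : 0 <= s by exact: powR_ge0.
  have : s ^+ 3 < S ^+ 3 by rewrite ltrXn2r.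
  rewrite s3 ltNge => /negP; apply; apply/ltW; apply: lt_le_trans (truncnS_gt _) _.
  by rewrite ler_nat.
have [s0s s1] : s0 <= s /\ 1 <= s by move: Ss; rewrite ge_max => /andP.
by rewrite s2; split; [exact: hlow|exact: hup].
Qed.
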